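(* Let $M$ be a $\lambda\mu$-term and let $t,s\in\mathcal T(M)$ with $t\neq s$. Then $\mathrm{nf}_r(t)\cap\mathrm{nf}_r(s)=\emptyset$.
   Context: Fix disjoint countably infinite sets of variables and names. $\lambda\mu$-terms: $M::=x\mid\lambda x.M\mid MM\mid\mu\alpha.{}_\beta|M|$, up to renaming of bound variables and names. Resource terms and sums. - Resource terms: $t::=x\mid\lambda x.t\mid t[t_1,\dots,t_n]\mid\mu\alpha.{}_\beta|t|$, with $[t_1,\dots,t_n]$ a finite multiset (bag); $1$ is the empty bag and $*$ is multiset union. - Sums are finite sets of resource terms, written with idempotent $+$ and empty sum $0$. Constructors extend multilinearly to sums, and $0$ annihilates. - A weak composition (w.c.) of a bag $B$ is a tuple $(B_0,\dots,B_k)$ of possibly empty bags with $B_0*\dots*B_k=B$. Linear substitution $t\langle B/x\rangle$: - $x\langle[v]/x\rangle=v$, and $x\langle B/x\rangle=0$ otherwise. - For $y\neq x$: $y\langle1/x\rangle=y$, and $y\langle B/x\rangle=0$ if $B\ne1$. - It commutes with $\lambda y$ and with $\mu\alpha.{}_\beta|\cdot|$. - $(t[v_1..v_n])\langle B/x\rangle=\sum_{(B_0..B_n)\text{ w.c. of }B}t\langle B_0/x\rangle[v_1\langle B_1/x\rangle,\dots,v_n\langle B_n/x\rangle]$. Linear named application $\langle t\rangle_\alpha B$: - $\langle x\rangle_\alpha1=x$, and $\langle x\rangle_\alpha B=0$ if $B\ne1$. - It commutes with $\lambda y$, and $\langle\mu\gamma.{}_\eta|t|\rangle_\alpha B=\mu\gamma.\langle{}_\eta|t|\rangle_\alpha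 B$. - $\langle{}_\eta|t|\rangle_\alpha B={}_\eta|\langle t\rangle_\alpha B|$ for $\eta\ne\alpha$. - $\langle{}_\alpha|t|\rangle_\alpha B=\sum_{(B_1,B_2)\text{ w.c. of }B}{}_\alpha|(\langle t\rangle_\alpha B_1)B_2|$. - $\langle t[v_1..v_n]\rangle_\alpha B=\sum_{(B_0..B_n)}(\langle t\rangle_\alpha B_0)[\langle v_1\rangle_\alpha B_1,\dots,\langle v_n\rangle_\alpha B_n]$. Resource reduction. $\to_r$ is the closure under single-hole resource contexts of $(\lambda x.t)B\to t\langle B/x\rangle$, $(\mu\alpha.{}_\beta|t|)B\to\mu\alpha.\langle{}_\beta|t|\rangle_\alpha B$, and $\mu\gamma.{}_\alpha|\mu\beta.{}_\eta|t||\to\mu\gamma.({}_\eta|t|)\{\alpha/\beta\}$ (renaming of free $\beta$ into $\alpha$). It is extended to sums by $t+\mathcal S\to_r\mathcal T+\mathcal S$ when $t\to_r\mathcal T$ and $t\notin\mathcal S$. It is confluent and strongly normalising, so each resource term $t$ has a unique normal form $\mathrm{nf}_r(t)$ (a sum, i.e. a finite set, possibly empty). Taylor expansion. - $\mathcal T(x)=\{x\}$, $\mathcal T(\lambda x.M)=\{\lambda x.t\mid t\in\mathcal T(M)\}$, $\mathcal T(\mu\alpha.{}_\beta|M|)=\{\mu\alpha.{}_\beta|t|\mid t\in\mathcal T(M)\}$. - $\mathcal T(MN)=\{t[u_1,\dots,u_n]\mid t\in\mathcal T(M),n\ge0,u_i\in\mathcal T(N)\}$. *)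

(* Defs.v *)
From HB Require Import structures.
From mathcomp Require Import all_boot.
From mathcomp Require Import finmap multiset.
From Stdlib Require Import Relation_Operators.

Set Implicit Arguments.
Unset Strict Implicit.
Unset Printing Implicit Defensive.

Local Open Scope fset_scope.
Local Open Scope mset_scope.
Local Open Scope nat_scope.

(* Terms up to renaming of bound variables and names are represented with de
   Bruijn indices: one index space for variables (bound by lambda) and a
   separate one for names (bound by mu).  In [LMu b M], representing
   mu alpha. _beta|M|, the index [b] of beta is read inside the scope of the
   binder, so [b = 0] means beta = alpha. *)

Inductive lmterm : Type :=
  | LVar of nat
  | LLam of lmterm
  | LApp of lmterm & lmterm
  | LMu of nat & lmterm.

(* Pre-terms: resource terms whose bags are lists.  Resource terms proper
   ([rterm] below) are pre-terms modulo permutation of all bags. *)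
Inductive pterm : Type :=
  | PVar of nat
  | PLam of pterm
  | PApp of pterm & seq pterm
  | PMu of nat & pterm.

Lemma pterm_nested_ind (P : pterm -> Prop) :
  (forall n, P (PVar n)) ->
  (forall t, P t -> P (PLam t)) ->
  (forall t vs, P t -> (forall i, P (nth (PVar 0) vs i)) ->
     P (PApp t vs)) ->
  (forall b t, P t -> P (PMu b t)) ->
  forall t, P t.
Proof.
move=> Hv Hl Ha Hm; fix IH 1; case=> [n|t|t vs|b t].
- exact: Hv.
- exact/Hl/IH.
- apply: Ha; first exact: IH.
  elim: vs => [|v vs IHvs] i; first by rewrite nth_nil; exact: Hv.
  by case: i => [|i]; [exact: IH v | exact: IHvs].
- exact/Hm/IH.
Qed.

Fixpoint pterm_enc (t : pterm) : GenTree.tree nat :=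
  match t with
  | PVar n => GenTree.Leaf n
  | PLam t => GenTree.Node 0 [:: pterm_enc t]
  | PApp t vs => GenTree.Node 1 (pterm_enc t :: map pterm_enc vs)
  | PMu b t => GenTree.Node b.+2 [:: pterm_enc t]
  end.

Fixpoint pterm_dec (t : GenTree.tree nat) : pterm :=
  match t with
  | GenTree.Leaf n => PVar n
  | GenTree.Node 0 [:: u] => PLam (pterm_dec u)
  | GenTree.Node 1 (u :: us) => PApp (pterm_dec u) (map pterm_dec us)
  | GenTree.Node b.+2 [:: u] => PMu b (pterm_dec u)
  | _ => PVar 0
  end.

Lemma pterm_encK : cancel pterm_enc pterm_dec.
Proof.
elim/pterm_nested_ind => //= [t ->|t vs -> IH|b t ->] //.
congr PApp; rewrite -map_comp; apply: (@eq_from_nth _ (PVar 0)).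
  by rewrite size_map.
by move=> i; rewrite size_map => lt_i; rewrite (nth_map (PVar 0)) //= IH.
Qed.

HB.instance Definition _ := Countable.copy pterm (can_type pterm_encK).

(* An arbitrary total order on pre-terms, used only to pick one listing of
   each bag. *)
Definition pterm_le (t u : pterm) : bool := choice.pickle t <= choice.pickle u.

Lemma pterm_le_total : total pterm_le.
Proof. by move=> t u; exact: leq_total. Qed.

Lemma pterm_le_trans : transitive pterm_le.
Proof. by move=> t u v; exact: leq_trans. Qed.

Lemma pterm_le_anti : antisymmetric pterm_le.
Proof.
by move=> t u; rewrite /pterm_le -eqn_leq => /eqP /(pcan_inj choice.pickleK).
Qed.

Fixpoint canon (t : pterm) : pterm :=
  match t with
  | PVar n => PVar n
  | PLam t => PLam (canon t)
  | PApp t vs => PApp (canon t) (sort pterm_le (map canon vs))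
  | PMu b t => PMu b (canon t)
  end.

Lemma canon_idem t : canon (canon t) = canon t.
Proof.
elim/pterm_nested_ind: t => //= [t ->|t vs -> IH|b t ->] //.
have fixc : {in map canon vs, canon =1 id}.
  move=> _ /mapP [v vsv ->]; rewrite -(nth_index (PVar 0) vsv).
  exact: IH.
congr PApp; rewrite (_ : map canon _ = sort pterm_le (map canon vs)).
  exact/sorted_sort/sort_sorted/pterm_le_total/pterm_le_trans.
by apply: map_id_in => v; rewrite mem_sort; exact: fixc.
Qed.

(* Resource terms: one canonical pre-term per class modulo permutation of
   bags, so that Leibniz equality on [rterm] treats bags as multisets. *)
Record rterm : Type := RTerm { rep : pterm; _ : canon rep == rep }.

HB.instance Definition _ := [isSub for rep].
HB.instance Definition _ := [Countable of rterm by <:].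

Definition cls (t : pterm) : rterm := RTerm (introT eqP (canon_idem t)).

Definition rvar (n : nat) : rterm := cls (PVar n).
Definition rlam (t : rterm) : rterm := cls (PLam (rep t)).
Definition rapp (t : rterm) (B : {mset rterm}) : rterm :=
  cls (PApp (rep t) (map rep B)).
Definition rmu (b : nat) (t : rterm) : rterm := cls (PMu b (rep t)).

(* Simultaneous renaming of variables (by [f]) and names (by [g]). *)
Definition up_ren (f : nat -> nat) (n : nat) : nat :=
  if n is m.+1 then (f m).+1 else 0.

Fixpoint pren (f g : nat -> nat) (t : pterm) : pterm :=
  match t with
  | PVar n => PVar (f n)
  | PLam t => PLam (pren (up_ren f) g t)
  | PApp t vs => PApp (pren f g t) (map (pren f g) vs)
  | PMu b t => PMu (up_ren g b) (pren f (up_ren g) t)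
  end.

Definition liftV (B : seq pterm) : seq pterm := map (pren succn id) B.
Definition liftN (B : seq pterm) : seq pterm := map (pren id succn) B.

(* All weak compositions of the list [B] into [k] lists: each occurrence in [B]
   goes to one of the [k] components.  Every weak composition of the underlying
   bag is listed up to permutation, possibly several times; repetitions are
   harmless as sums are idempotent. *)
Definition push_at (T : Type) (i : nat) (v : T) (Bs : seq (seq T)) :=
  set_nth [::] Bs i (v :: nth [::] Bs i).

Fixpoint wcomps (T : Type) (k : nat) (B : seq T) : seq (seq (seq T)) :=
  if B is v :: B' then [seq push_at i v Bs | Bs <- wcomps k B', i <- iota 0 k]
  else [:: nseq k [::]].

Fixpoint cart (T : Type) (Ss : seq (seq T)) : seq (seq T) :=
  if Ss is A :: Ss' then [seq u :: us | u <- A, us <- cart Ss'] else [:: [::]].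

(* The sum over (B_0, ..., B_n) of  f(B_0)[g_1(B_1), ..., g_n(B_n)],  where
   [f] and [gs] = [:: g_1; ...; g_n] map bags to sums and application is
   extended multilinearly. *)
Definition distribute (f : seq pterm -> seq pterm)
    (gs : seq (seq pterm -> seq pterm)) (B : seq pterm) : seq pterm :=
  flatten [seq [seq PApp u us
                  | u <- f (head [::] Bs),
                    us <- cart [seq p.1 p.2 | p <- zip gs (behead Bs)]]
             | Bs <- wcomps (size gs).+1 B].

(* Linear substitution of [B] for the variable of index [k], followed by the
   removal of this index (variables above [k] are decremented). *)
Fixpoint plsubst (t : pterm) (k : nat) (B : seq pterm) : seq pterm :=
  match t with
  | PVar n =>
      if n == k then (if B is [:: v] then [:: v] else [::])
      else if B is [::] then [:: PVar (if k < n then n.-1 else n)] else [::]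
  | PLam t => [seq PLam u | u <- plsubst t k.+1 (liftV B)]
  | PApp t vs =>
      distribute (plsubst t k) [seq (plsubst v k : seq pterm -> _) | v <- vs] B
  | PMu b t => [seq PMu b u | u <- plsubst t k (liftN B)]
  end.

(* Linear named application on a named term _e|t|, given the linear named
   application [f] on t. *)
Definition named_app (f : seq pterm -> seq pterm) (e a : nat) (B : seq pterm) :
    seq (nat * pterm) :=
  if e == a then
    flatten [seq [seq (e, PApp u (nth [::] Bs 1)) | u <- f (nth [::] Bs 0)]
               | Bs <- wcomps 2 B]
  else [seq (e, u) | u <- f B].

Fixpoint plnapp (t : pterm) (a : nat) (B : seq pterm) : seq pterm :=
  match t with
  | PVar n => if B is [::] then [:: PVar n] else [::]
  | PLam t => [seq PLam u | u <- plnapp t a (liftV B)]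
  | PApp t vs =>
      distribute (plnapp t a) [seq (plnapp v a : seq pterm -> _) | v <- vs] B
  | PMu e t => [seq PMu p.1 p.2 | p <- named_app (plnapp t a.+1) e a.+1 (liftN B)]
  end.

Notation rsum := {fset rterm}.

(* t<B/x>, where x is the variable bound by the innermost lambda around t, and
   B lives outside of that lambda. *)
Definition lsubst (t : rterm) (B : {mset rterm}) : rsum :=
  [fset cls u | u in plsubst (rep t) 0 (map rep B)].

(* mu alpha. <_b|t|>_alpha B, for a bag B living outside of the binder. *)
Definition mu_lnapp (b : nat) (t : rterm) (B : {mset rterm}) : rsum :=
  [fset cls (PMu p.1 p.2)
     | p in named_app (plnapp (rep t) 0) b 0 (liftN (map rep B))].

(* The renaming {alpha/beta} of name index 0 (beta) into [a] (alpha), removing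
   the binder of beta. *)
Definition nsubst (a : nat) (n : nat) : nat := if n is m.+1 then m else a.

Definition rnsubst (a : nat) (t : rterm) : rterm :=
  cls (pren id (nsubst a) (rep t)).

Inductive red : rterm -> rsum -> Prop :=
  | red_lam t B : red (rapp (rlam t) B) (lsubst t B)
  | red_mu b t B : red (rapp (rmu b t) B) (mu_lnapp b t B)
  | red_rho a e t :
      red (rmu a (rmu e t)) [fset rmu (nsubst a e) (rnsubst a t)]
  | red_ctx_lam t S : red t S -> red (rlam t) [fset rlam u | u in S]
  | red_ctx_fun t S B : red t S -> red (rapp t B) [fset rapp u B | u in S]
  | red_ctx_arg t v S B :
      red v S -> red (rapp t (v +` B)) [fset rapp t (u +` B) | u in S]
  | red_ctx_mu b t S : red t S -> red (rmu b t) [fset rmu b u | u in S].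

Inductive red_sum : rsum -> rsum -> Prop :=
  | red_sum_step (t : rterm) (T S : rsum) :
      red t T -> t \notin S -> red_sum (t |` S)%fset (T `|` S)%fset.

(* [is_nf t S]: the sum S is the normal form nf_r(t). *)
Definition is_nf (t : rterm) (S : rsum) : Prop :=
  clos_refl_trans rsum red_sum [fset t]%fset S /\
  (forall S' : rsum, ~ red_sum S S').

Fixpoint taylor (M : lmterm) : rterm -> Prop :=
  match M with
  | LVar n => fun t => t = rvar n
  | LLam M => fun t => exists2 u, taylor M u & t = rlam u
  | LApp M N => fun t => exists u (B : {mset rterm}),
      [/\ taylor M u, (forall v, v \in B -> taylor N v) & t = rapp u B]
  | LMu b M => fun t => exists2 u, taylor M u & t = rmu b u
  end.

(* Main.v *)
(* If a normal term u is a summand of a normal form of t, then u is reached from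
   t along a thread: a sequence of terms, each a summand of a reduct of the
   previous one.  A thread ending in a normal form can be reordered so as to
   start with the head redex (no confluence is needed).  All the elements of
   T(M) share the same spine, hence fire the same head redex, and a head step
   is injective on pairwise coherent terms: its result determines the term and
   the bags it consumed.  By induction along head reduction, and then inside
   the bags of head normal forms, two coherent terms with a common normal
   summand are equal.

   Substitution, named application and renaming are treated at once, as
   instances of a linear action of an environment which is closed under
   composition and decomposition; exchanging two redexes means composing two
   actions and decomposing the result in the other order. *)
From mathcomp Require Import all_boot.
From mathcomp Require Import finmap multiset.
From mathcomp Require Import zify.
From Stdlib Require Import Relation_Operators.
Require Import Defs.

Set Implicit Arguments.
Unset Strict Implicit.
Unset Printing Implicit Defensive.

Local Open Scope fset_scope.
Local Open Scope mset_scope.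
Local Open Scope nat_scope.

(** Equality of multisets gives no preferred matching between the bags of two terms. Bags are
    therefore handled as lists, threads may relist them freely, and coherence is demanded of any two
    elements of the two bags, so that it holds for whichever matching a common normal form imposes.
    A multiset of keyed resources cannot record that one named subterm receives two bags in
    succession, since the result would be a nested application; this is why composition is
    restricted to compatible environments. The delicate exchange is with a rho-redex: a bag sent to
    its outer name is applied to the inner mu as a whole, and that new mu-redex has to be fired
    before the rho-redex comes back. One step is thus exchanged for several, and exchanging
    lengthens threads. The main induction consequently ignores the length of threads. It follows a
    measure lowered by head steps: the number of abstractions, then of mu-binders, then of the
    applications to which the bags can still give rise by mu-reduction. A size component then allows
    the passage to subterms. *)

Lemma pterm_ind_in (P : pterm -> Prop) :
  (forall n, P (PVar n)) ->
  (forall t, P t -> P (PLam t)) ->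
  (forall t vs, P t -> (forall v, v \in vs -> P v) -> P (PApp t vs)) ->
  (forall b t, P t -> P (PMu b t)) ->
  forall t, P t.
Proof.
move=> Hv Hl Ha Hm; elim/pterm_nested_ind => // t vs Pt Pvs; apply: Ha => //.
by move=> v v_in; rewrite -(nth_index (PVar 0) v_in).
Qed.

(** * Permutations of lists and renamings of pre-terms *)

Section Perm.
Variables T U : eqType.

Lemma perm_map_inv (f : T -> U) s1 s2 :
  perm_eq s2 (map f s1) -> exists2 s, perm_eq s1 s & s2 = map f s.
Proof.
elim: s2 s1 => [|x s2 IH] s1 H.
  by exists [::] => //; move/perm_size: H; rewrite size_map; case: s1.
have /mapP[y ys1 xE] : x \in map f s1 by rewrite -(perm_mem H) mem_head.
have := perm_trans H (perm_map f (perm_to_rem ys1)).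
rewrite /= xE perm_cons => /IH[s ps ->]; exists (y :: s) => //.
by apply: (perm_trans (perm_to_rem ys1)); rewrite perm_cons.
Qed.

Lemma perm_cons_cat_inv (x : T) s a b :
  perm_eq (x :: s) (a ++ b) ->
  (exists2 a', perm_eq a (x :: a') & perm_eq s (a' ++ b)) \/
  (exists2 b', perm_eq b (x :: b') & perm_eq s (a ++ b')).
Proof.
move=> H; have : x \in a ++ b by rewrite -(perm_mem H) mem_head.
rewrite mem_cat => /orP[xa|xb]; [left|right].
  exists (rem x a); first exact: perm_to_rem.
  rewrite -(perm_cons x); apply: (perm_trans H).
  by rewrite -cat_cons perm_cat2r; exact: perm_to_rem.
exists (rem x b); first exact: perm_to_rem.
rewrite -(perm_cons x); apply: (perm_trans H).
rewrite perm_sym -cat1s perm_catCA perm_cat2l cat1s perm_sym.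
exact: perm_to_rem.
Qed.

End Perm.

Lemma perm_nilE (T : eqType) (s : seq T) : perm_eq s [::] -> s = [::].
Proof. by move/perm_nilP. Qed.

Lemma up_ren_ext f g : f =1 g -> up_ren f =1 up_ren g.
Proof. by move=> H [|n] //=; rewrite H. Qed.

Lemma up_ren_comp f g : up_ren f \o up_ren g =1 up_ren (f \o g).
Proof. by case. Qed.

Lemma up_ren_inj f : injective f -> injective (up_ren f).
Proof. by move=> H [|m] [|n] //= [/H->]. Qed.

Lemma pren_ext t : forall f g f' g', f =1 f' -> g =1 g' ->
  pren f g t = pren f' g' t.
Proof.
elim/pterm_ind_in: t => [n|t IH|t vs IHt IH|b t IH] f g f' g' Hf Hg /=.
- by rewrite Hf.
- by congr PLam; apply: IH => //; exact: up_ren_ext.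
- congr PApp; first exact: IHt.
  by apply/eq_in_map => v vin; exact: IH.
- by congr PMu; [exact: up_ren_ext | apply: IH => //; exact: up_ren_ext].
Qed.

Lemma pren_comp t : forall f g f' g',
  pren f g (pren f' g' t) = pren (f \o f') (g \o g') t.
Proof.
elim/pterm_ind_in: t => [n|t IH|t vs IHt IH|b t IH] f g f' g' //=.
- by rewrite IH; congr PLam; apply: pren_ext => //; exact: up_ren_comp.
- rewrite IHt -map_comp; congr PApp.
  by apply/eq_in_map => v vin; exact: IH.
- rewrite IH; congr PMu; first exact: up_ren_comp.
  by apply: pren_ext => //; exact: up_ren_comp.
Qed.

Lemma pren_id t : pren id id t = t.
Proof.
have up_id : up_ren id =1 id by case.
elim/pterm_ind_in: t => [n|t IH|t vs IHt IH|b t IH] //=.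
- by rewrite (pren_ext _ up_id (frefl _)) IH.
- rewrite IHt; congr PApp; rewrite -[RHS]map_id.
  by apply/eq_in_map => v vin; exact: IH.
- by rewrite up_id (pren_ext _ (frefl _) up_id) IH.
Qed.

(** * Linear actions *)

(* Keys of resources: [inl] for variables and [inr] for names. *)
Notation key := (nat + nat)%type.
Notation res := (key * pterm)%type.

(* [vr n = None] marks the variables to be substituted, the others being
   renamed; [na n] marks the names whose named subterms receive a bag, all
   names being renamed by [nr]. *)
Record env := Env { vr : nat -> option nat; nr : nat -> nat; na : nat -> bool }.

(* The boolean selects the binder: [true] for lambda, [false] for mu. *)
Definition shift (c : bool) : pterm -> pterm :=
  if c then pren succn id else pren id succn.

Definition shift_key (c : bool) (k : key) : key :=
  match c, k with
  | true, inl n => inl n.+1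
  | false, inr n => inr n.+1
  | _, _ => k
  end.

Definition shift_res c (p : res) : res := (shift_key c p.1, shift c p.2).

Definition lift_res (c : bool) (R : seq res) : seq res := map (shift_res c) R.

Definition up_env (c : bool) (th : env) : env :=
  if c then
    Env (fun n => if n is m.+1 then omap succn (vr th m) else Some 0)
        (nr th) (na th)
  else
    Env (vr th) (up_ren (nr th)) (fun n => if n is m.+1 then na th m else false).

Section BagRel.
Variable P : pterm -> seq res -> pterm -> Prop.

(** [P] is a section variable, outside the fixpoint, so that [act] may recurse through it on the
    elements of a bag. *)
Fixpoint bag_rel (vs : seq pterm) (R : seq res) (us : seq pterm) : Prop :=
  match vs, us with
  | [::], [::] => R = [::]
  | v :: vs, u :: us => exists R0 R1,
      [/\ perm_eq R (R0 ++ R1), P v R0 u & bag_rel vs R1 us]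
  | _, _ => False
  end.

End BagRel.

Definition keyed (k : key) (B : seq pterm) : seq res := map (pair k) B.

(** [th] and [R] are read inside the mu-binder, like [b] itself. The active case is the rule for a
    subterm named by the name of the application: [R1] is spent inside, and the bag [B] of the
    remaining resources becomes an argument. *)
Definition named_rel (P : seq res -> pterm -> Prop) (th : env)
    (R : seq res) (b c : nat) (u : pterm) : Prop :=
  c = nr th b /\
  if na th b then exists R1 B u',
    [/\ u = PApp u' B, perm_eq R (R1 ++ keyed (inr b) B) & P R1 u']
  else P R u.

(* [u] is a summand of the action on [t] of the environment [th], where each
   resource of [R] is used exactly once.  Linear substitution, linear named
   application and renaming are all of this form, which is closed under
   composition. *)
Fixpoint act (t : pterm) (th : env) (R : seq res) (u : pterm) : Prop :=
  match t with
  | PVar n =>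
      if vr th n is Some m then R = [::] /\ u = PVar m
      else R = [:: (inl n, u)]
  | PLam t => exists2 u', u = PLam u' & act t (up_env true th) (lift_res true R) u'
  | PApp t vs => exists u' us R0 R1,
      [/\ u = PApp u' us, perm_eq R (R0 ++ R1), act t th R0 u' &
          bag_rel (fun v R u => act v th R u) vs R1 us]
  | PMu b t => exists c u', u = PMu c u' /\
      named_rel (fun R u => act t (up_env false th) R u) (up_env false th)
        (lift_res false R) b c u'
  end.

Definition acts th vs R us := bag_rel (fun v R u => act v th R u) vs R us.
(** The action on a named term, without its binder. A mu-step or a rho-step acts on the name that
    the binder introduces, which the lifted environment used by [act] on [PMu] never marks. *)
Definition nact b t th R c u := named_rel (act t th) th R b c u.

(** With the triples listed, permuting the arguments or the results amounts to permuting a single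
    list. *)
Lemma bag_relP P vs R us :
  bag_rel P vs R us <->
  exists L : seq (pterm * seq res * pterm),
    [/\ vs = [seq x.1.1 | x <- L], us = [seq x.2 | x <- L],
        perm_eq R (flatten [seq x.1.2 | x <- L]) &
        forall x, x \in L -> P x.1.1 x.1.2 x.2].
Proof.
split.
  elim: vs R us => [|v vs IH] R [|u us] //=; first by move=> ->; exists [::].
  move=> [R0 [R1 [H Hv /IH[L [-> -> HL HP]]]]].
  exists ((v, R0, u) :: L); split=> //=.
    by apply: (perm_trans H); rewrite perm_cat2l.
  by move=> x; rewrite inE => /orP[/eqP->|/HP].
move=> [L [-> -> HR HP]]; elim: L R HR HP => [|[[v R0] u] L IH] R /= HR HP.
  exact: perm_nilE.
exists R0, (flatten [seq x.1.2 | x <- L]); split=> //.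
  exact: (HP (v, R0, u) (mem_head _ _)).
by apply: IH => // x xL; apply: HP; rewrite inE xL orbT.
Qed.

Lemma bag_rel_perm P vs R R' us :
  perm_eq R R' -> bag_rel P vs R us -> bag_rel P vs R' us.
Proof.
move=> H /bag_relP[L [-> -> HL HP]]; apply/bag_relP; exists L; split=> //.
by rewrite perm_sym in H; exact: perm_trans H HL.
Qed.

Lemma bag_rel_perm_in P vs vs' R us :
  bag_rel P vs R us -> perm_eq vs' vs ->
  exists2 us', perm_eq us us' & bag_rel P vs' R us'.
Proof.
move=> /bag_relP[L [-> -> HL HP]] /perm_map_inv[L' HLL' ->].
exists [seq x.2 | x <- L']; first exact: perm_map.
apply/bag_relP; exists L'; split=> //.
  by apply: (perm_trans HL); apply/perm_flatten/perm_map.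
by move=> x; rewrite -(perm_mem HLL'); exact: HP.
Qed.

Lemma bag_rel_perm_out P vs us' R us :
  bag_rel P vs R us -> perm_eq us' us ->
  exists2 vs', perm_eq vs vs' & bag_rel P vs' R us'.
Proof.
move=> /bag_relP[L [-> -> HL HP]] /perm_map_inv[L' HLL' ->].
exists [seq x.1.1 | x <- L']; first exact: perm_map.
apply/bag_relP; exists L'; split=> //.
  by apply: (perm_trans HL); apply/perm_flatten/perm_map.
by move=> x; rewrite -(perm_mem HLL'); exact: HP.
Qed.

Lemma bag_rel_sub P Q vs R us :
  (forall v R u, v \in vs -> P v R u -> Q v R u) ->
  bag_rel P vs R us -> bag_rel Q vs R us.
Proof.
elim: vs R us => [|v vs IH] R [|u us] //= H [R0 [R1 [HR Hv Hvs]]].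
exists R0, R1; split=> //; first by apply: H => //; exact: mem_head.
by apply: IH => // w R' u' win; apply: H; rewrite inE win orbT.
Qed.

Lemma lift_res_perm c R R' : perm_eq R R' -> perm_eq (lift_res c R) (lift_res c R').
Proof. exact: perm_map. Qed.

Lemma lift_res_cat c R R' : lift_res c (R ++ R') = lift_res c R ++ lift_res c R'.
Proof. exact: map_cat. Qed.

Lemma keyed_cat k B B' : keyed k (B ++ B') = keyed k B ++ keyed k B'.
Proof. exact: map_cat. Qed.

Lemma keyed_perm k B B' : perm_eq B B' -> perm_eq (keyed k B) (keyed k B').
Proof. exact: perm_map. Qed.

Lemma perm_seq1 (T : eqType) (x : T) s : perm_eq [:: x] s -> s = [:: x].
Proof. by rewrite perm_sym; exact: perm_small_eq. Qed.

Lemma named_rel_perm P th R R' b c u :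
  (forall R R' u, perm_eq R R' -> P R u -> P R' u) ->
  perm_eq R R' -> named_rel P th R b c u -> named_rel P th R' b c u.
Proof.
move=> HP HR [-> H]; split=> //; move: H; case: (na th b); last exact: HP.
move=> [R1 [B [u' [-> H Hu]]]]; exists R1, B, u'; split=> //.
by rewrite perm_sym in HR; exact: perm_trans HR H.
Qed.

Lemma act_perm t th R R' u : perm_eq R R' -> act t th R u -> act t th R' u.
Proof.
elim/pterm_ind_in: t th R R' u => [n|t IH|t vs _ _|b t IH] th R R' u HR /=.
- case: (vr th n) => [m [E ->]|E]; rewrite E in HR.
    by split=> //; apply: perm_nilE; rewrite perm_sym.
  exact: perm_seq1.
- move=> [u' -> H]; exists u' => //; exact: IH (lift_res_perm true HR) H.
- move=> [u' [us [R0 [R1 [-> HR01 H0 H1]]]]]; exists u', us, R0, R1; split=> //.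
  by rewrite perm_sym in HR; exact: perm_trans HR HR01.
- move=> [c [u' [-> H]]]; exists c, u'; split=> //.
  by apply: named_rel_perm (lift_res_perm false HR) H => ? ? ?; exact: IH.
Qed.

Definition eq_env th th' :=
  [/\ vr th =1 vr th', nr th =1 nr th' & na th =1 na th'].

Lemma eq_env_up c th th' : eq_env th th' -> eq_env (up_env c th) (up_env c th').
Proof.
by case: c => -[Hv Hr Ha]; split=> //= -[|n] //=; rewrite ?Hv ?Hr ?Ha.
Qed.

Lemma act_ext t th th' R u : eq_env th th' -> act t th R u -> act t th' R u.
Proof.
elim/pterm_ind_in: t th th' R u => [n|t IH|t vs IHt IH|b t IH] th th' R u E /=.
- by case: E => -> _ _.
- move=> [u' -> H]; exists u' => //; exact: IH (eq_env_up true E) H.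
- move=> [u' [us [R0 [R1 [-> HR01 H0 H1]]]]]; exists u', us, R0, R1; split=> //.
    exact: IHt E H0.
  by apply: bag_rel_sub H1 => v S w vin; exact: IH.
- move=> [c [u' [-> [-> H]]]]; exists (nr (up_env false th') b), u'.
  have E' := eq_env_up false E; case: (E') => _ Hr Ha.
  split; first by rewrite Hr.
  split=> //; move: H; rewrite Ha; case: ifP => _; last exact: IH.
  move=> [R1 [B [u1 [-> HR H]]]]; exists R1, B, u1; split=> //; exact: IH H.
Qed.

Lemma nact_ext b t th th' R c u :
  eq_env th th' -> nact b t th R c u -> nact b t th' R c u.
Proof.
move=> E [-> H]; case: (E) => _ Hr Ha; split=> //; move: H; rewrite Ha.
case: ifP => _; last exact: act_ext.
move=> [R1 [B [u1 [-> HR H]]]]; exists R1, B, u1; split=> //; exact: act_ext H.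
Qed.

Lemma nact_perm b t th R R' c u :
  perm_eq R R' -> nact b t th R c u -> nact b t th R' c u.
Proof. by apply: named_rel_perm => ? ? ?; exact: act_perm. Qed.

Definition ren_key (f g : nat -> nat) (k : key) : key :=
  match k with inl n => inl (f n) | inr n => inr (g n) end.

(** A key is an index of the term acted upon, whereas the payload lives in the context of the
    result: hence two independent pairs of renamings. *)
Definition ren_res f g f' g' (p : res) : res :=
  (ren_key f g p.1, pren f' g' p.2).

Lemma ren_key_inj f g : injective f -> injective g -> injective (ren_key f g).
Proof. by move=> Hf Hg [m|m] [n|n] //= [] => [/Hf|/Hg] ->. Qed.

Lemma lift_ren_v R f g f' g' :
  lift_res true (map (ren_res f g f' g') R) =
  map (ren_res (up_ren f) g (up_ren f') g') (lift_res true R).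
Proof.
rewrite /lift_res -!map_comp; apply: eq_map => -[[n|n] v];
  by rewrite /ren_res /shift_res /= !pren_comp.
Qed.

Lemma lift_ren_n R f g f' g' :
  lift_res false (map (ren_res f g f' g') R) =
  map (ren_res f (up_ren g) f' (up_ren g')) (lift_res false R).
Proof.
rewrite /lift_res -!map_comp; apply: eq_map => -[[n|n] v];
  by rewrite /ren_res /shift_res /= !pren_comp.
Qed.

Definition ren_square th th' f g f' g' :=
  [/\ injective f, injective g, forall n, vr th' (f n) = omap f' (vr th n),
      forall n, nr th' (g n) = g' (nr th n) & forall n, na th' (g n) = na th n].

Lemma ren_square_v th th' f g f' g' : ren_square th th' f g f' g' ->
  ren_square (up_env true th) (up_env true th') (up_ren f) g (up_ren f') g'.
Proof.
move=> [If Ig Hv Hr Ha]; split=> //=; first exact: up_ren_inj.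
by case=> [|n] //=; rewrite Hv; case: (vr th n).
Qed.

Lemma ren_square_n th th' f g f' g' : ren_square th th' f g f' g' ->
  ren_square (up_env false th) (up_env false th') f (up_ren g) f' (up_ren g').
Proof.
move=> [If Ig Hv Hr Ha]; split=> //=; first exact: up_ren_inj.
  by case=> [|n] //=; rewrite Hr.
by case=> [|n] //=; rewrite Ha.
Qed.

Lemma map_cat_inv (T U : Type) (f : T -> U) s a b :
  map f s = a ++ b -> exists s1 s2, [/\ s = s1 ++ s2, map f s1 = a & map f s2 = b].
Proof.
elim: a s => [|x a IH] s /=; first by exists [::], s.
by case: s => //= y s [<- /IH[s1 [s2 [-> <- <-]]]]; exists (y :: s1), s2.
Qed.

Lemma perm_map_cat_inv (T U : eqType) (f : T -> U) s a b :
  perm_eq (map f s) (a ++ b) -> exists s1 s2,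
    [/\ perm_eq s (s1 ++ s2), map f s1 = a & map f s2 = b].
Proof.
rewrite perm_sym => /perm_map_inv[s' Hs /esym/map_cat_inv[s1 [s2 [E <- <-]]]].
by exists s1, s2; rewrite -E.
Qed.

Lemma ren_keyed_inv f g f' g' k S B : injective f -> injective g ->
  map (ren_res f g f' g') S = keyed (ren_key f g k) B ->
  exists2 B0, S = keyed k B0 & B = map (pren f' g') B0.
Proof.
move=> If Ig; elim: S B => [|[k0 v] S IH] [|w B] //=; first by exists [::].
move=> [/(ren_key_inj If Ig)-> <- /IH[B0 -> ->]]; by exists (v :: B0).
Qed.

Lemma ren_keyed f g f' g' k B :
  map (ren_res f g f' g') (keyed k B) =
  keyed (ren_key f g k) (map (pren f' g') B).
Proof. by rewrite /keyed -!map_comp. Qed.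

Lemma act_ren t : forall th th' f g f' g' R u,
  ren_square th th' f g f' g' -> act t th R u ->
  act (pren f g t) th' (map (ren_res f g f' g') R) (pren f' g' u).
Proof.
elim/pterm_ind_in: t => [n|t IH|t vs IHt IH|b t IH] th th' f g f' g' R u SQ /=.
- case: (SQ) => _ _ -> _ _.
  by case: (vr th n) => [m [-> ->]|->].
- move=> [u' -> H]; exists (pren (up_ren f') g' u') => //.
  by rewrite lift_ren_v; apply: IH H; exact: ren_square_v.
- move=> [u' [us [R0 [R1 [-> HR H0 H1]]]]] /=.
  exists (pren f' g' u'), (map (pren f' g') us), (map (ren_res f g f' g') R0),
    (map (ren_res f g f' g') R1); split=> //.
    + by rewrite -map_cat; exact: perm_map.
    + exact: IHt H0.
    + elim: vs us R1 {HR} H1 IH => [|v vs IHvs] [|w us] R1 //= => [->|] //.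
      move=> [S0 [S1 [HS Hv Hvs]]] IH.
      exists (map (ren_res f g f' g') S0), (map (ren_res f g f' g') S1); split.
        by rewrite -map_cat; exact: perm_map.
        by apply: IH Hv => //; exact: mem_head.
      by apply: IHvs => // x xin; apply: IH; rewrite inE xin orbT.
- move=> [c [u' [-> [-> H]]]] /=; have SQ' := ren_square_n SQ.
  case: (SQ') => _ _ _ Hr Ha; exists (up_ren g' (up_ren (nr th) b)).
  exists (pren f' (up_ren g') u'); split=> //; split; first by rewrite Hr.
  rewrite Ha lift_ren_n; move: H; case: ifP => _; last exact: IH.
  move=> [R1 [B [u1 [-> HR H]]]].
  exists (map (ren_res f (up_ren g) f' (up_ren g')) R1),
    (map (pren f' (up_ren g')) B), (pren f' (up_ren g') u1); split=> //.
    by rewrite -(ren_keyed f (up_ren g) f' (up_ren g') (inr b)) -map_cat; exact: perm_map.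
  exact: IH H.
Qed.

(** Injectivity of [f] and [g] keeps distinct keys apart, so the resources spent at a renamed
    variable or name are the renamings of those spent at the original one. Its instance for shifts
    allows a result obtained under a binder to be lowered. *)
Lemma act_ren_inv t : forall th th' f g f' g' R w,
  ren_square th th' f g f' g' ->
  act (pren f g t) th' (map (ren_res f g f' g') R) w ->
  exists2 u, w = pren f' g' u & act t th R u.
Proof.
elim/pterm_ind_in: t => [n|t IH|t vs IHt IH|b t IH] th th' f g f' g' R w SQ /=.
- case: (SQ) => If Ig -> _ _.
  case: (vr th n) => [m [HR ->]|HR] /=.
    by exists (PVar m) => //; split=> //; case: R HR.
  have [[|u []] // -> [->]] := @ren_keyed_inv f g f' g' (inl n) R [:: w] If Ig HR.
  by exists u.
- move=> [w' -> ]; rewrite lift_ren_v => /(IH _ _ _ _ _ _ _ _ (ren_square_v SQ)).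
  by move=> [u -> H]; exists (PLam u) => //; exists u.
- move=> [w' [ws [R0 [R1 [-> HR H0 H1]]]]] /=.
  have [S0 [S1 [HS E0 E1]]] := perm_map_cat_inv HR.
  move: H0; rewrite -E0 => /(IHt _ _ _ _ _ _ _ _ SQ)[u -> Hu].
  suff [us -> Hus] : exists2 us, ws = map (pren f' g') us & acts th vs S1 us.
    by exists (PApp u us) => //; exists u, us, S0, S1.
  rewrite -{}E1 in H1; elim: vs ws S1 {HS HR} H1 IH => [|v vs IHvs] [|x ws] S1 //=.
    by move=> HS _; exists [::] => //; case: S1 HS.
  move=> [T0 [T1 [HT Hv Hvs]]] IH.
  have [T0' [T1' [HT' E0' E1']]] := perm_map_cat_inv HT; subst T0 T1.
  have [u1 -> Hu1] := IH _ (mem_head _ _) _ _ _ _ _ _ _ _ SQ Hv.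
  have [|us -> Hus] := IHvs _ _ Hvs.
    by move=> y yin; apply: IH; rewrite inE yin orbT.
  by exists (u1 :: us) => //; exists T0', T1'.
- move=> [c [w' [-> [-> H]]]] /=; have SQ' := ren_square_n SQ.
  case: (SQ') => If Ig _ Hr Ha; rewrite [up_ren (nr th') _]Hr.
  move: H; rewrite lift_ren_n [X in if X then _ else _]Ha /= => H.
  suff [u -> Hu] : exists2 u, w' = pren f' (up_ren g') u &
      nact b t (up_env false th) (lift_res false R) (up_ren (nr th) b) u.
    by exists (PMu (up_ren (nr th) b) u) => //; exists (up_ren (nr th) b), u.
  rewrite /nact /named_rel.
  move: H; rewrite [na (up_env false th) b]/=; case: ifP => _ H; last first.
    by have [u -> Hu] := IH _ _ _ _ _ _ _ _ SQ' H; exists u.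
  move: H => [R1 [B [u1 [-> HR H]]]].
  have [S0 [S1 [HS E0 E1]]] := perm_map_cat_inv HR; subst R1.
  have [B0 ES -> ] := @ren_keyed_inv _ _ _ _ (inr b) _ _ If Ig E1.
  have [u2 -> Hu] := IH _ _ _ _ _ _ _ _ SQ' H.
  exists (PApp u2 B0) => //; split=> //; exists S0, B0, u2; split=> //.
  by rewrite -ES.
Qed.

(** When the image of the renaming avoids everything active, no resource is spent. With [f] or [g] a
    shift, this says that a shifted bag is left alone by an action on index 0. *)
Lemma act_pren t : forall th f g f' g',
  (forall n, vr th (f n) = Some (f' n)) -> (forall n, nr th (g n) = g' n) ->
  (forall n, na th (g n) = false) ->
  act (pren f g t) th [::] (pren f' g' t).
Proof.
elim/pterm_ind_in: t => [n|t IH|t vs IHt IH|b t IH] th f g f' g' Hv Hr Ha /=.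
- by rewrite Hv.
- eexists; first by [].
  by apply: IH => // -[|n] //=; rewrite Hv.
- do 2!eexists; exists [::], [::]; split=> //; first exact: IHt.
  elim: vs IH => //= v vs IHvs IH; exists [::], [::]; split=> //.
    by apply: IH => //; exact: mem_head.
  by apply: IHvs => x xin; apply: IH; rewrite inE xin orbT.
- do 2!eexists; split=> //; split; first by case: b => //= b; rewrite Hr.
  rewrite (_ : na _ _ = false); last by case: b => //= b; rewrite Ha.
  by apply: IH => // -[|n] //=; rewrite ?Hr ?Ha.
Qed.

Lemma shift_square c th : 
  let f := if c then succn else id in let g := if c then id else succn in
  ren_square th (up_env c th) f g f g.
Proof.
case: c; split=> //=; try exact: succn_inj.
by move=> n; case: (vr th n).
Qed.

Lemma lift_resE c R :
  let f := if c then succn else id in let g := if c then id else succn in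
  lift_res c R = map (ren_res f g f g) R.
Proof. by case: c; apply: eq_map => -[[]]. Qed.

Lemma shiftE c v :
  let f := if c then succn else id in let g := if c then id else succn in
  shift c v = pren f g v.
Proof. by case: c. Qed.

Lemma act_shift c t th R u :
  act t th R u -> act (shift c t) (up_env c th) (lift_res c R) (shift c u).
Proof. by rewrite lift_resE !shiftE; apply/act_ren/shift_square. Qed.

Lemma act_shift_inv c t th R w :
  act (shift c t) (up_env c th) (lift_res c R) w ->
  exists2 u, w = shift c u & act t th R u.
Proof.
rewrite lift_resE !shiftE => /act_ren_inv H.
by have [u -> Hu] := H _ (shift_square c th); exists u; rewrite ?shiftE.
Qed.

(** * Composition of linear actions *)

Definition active (th : env) (k : key) : bool :=
  match k with inl n => vr th n == None | inr n => na th n end.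

(* The key of the second action which serves the inactive key [k] of the
   first one. *)
Definition key_image (th : env) (k : key) : option key :=
  match k with
  | inl n => omap inl (vr th n)
  | inr n => if na th n then None else Some (inr (nr th n))
  end.

Lemma key_image_active th k k' : key_image th k = Some k' -> active th k = false.
Proof. by case: k => n /=; [case: (vr th n) | case: (na th n)]. Qed.

(* [rcomp th1 th2 R1 R2 R]: acting with [R1] and then with [R2] amounts to
   acting once with [R].  A resource of [R] is either one of [R1] on which a
   part of [R2] has acted, or one of [R2]. *)
Inductive rcomp (th1 th2 : env) : seq res -> seq res -> seq res -> Prop :=
  | rcomp_nil : rcomp th1 th2 [::] [::] [::]
  | rcomp_fst k v w P R1 R2 R :
      active th1 k -> act v th2 P w -> rcomp th1 th2 R1 R2 R ->
      rcomp th1 th2 ((k, v) :: R1) (P ++ R2) ((k, w) :: R)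
  | rcomp_snd k k' w R1 R2 R :
      key_image th1 k = Some k' -> active th2 k' -> rcomp th1 th2 R1 R2 R ->
      rcomp th1 th2 R1 ((k', w) :: R2) ((k, w) :: R)
  | rcomp_perm R1 R1' R2 R2' R R' :
      perm_eq R1 R1' -> perm_eq R2 R2' -> perm_eq R R' ->
      rcomp th1 th2 R1 R2 R -> rcomp th1 th2 R1' R2' R'.

Definition env_comp (th1 th2 : env) : env :=
  Env (fun n => if vr th1 n is Some m then vr th2 m else None)
      (nr th2 \o nr th1)
      (fun n => na th1 n || na th2 (nr th1 n)).

(* No named subterm receives two bags. *)
Definition compat (th1 th2 : env) := forall n, na th1 n -> ~~ na th2 (nr th1 n).

Lemma env_comp_up c th1 th2 :
  eq_env (env_comp (up_env c th1) (up_env c th2)) (up_env c (env_comp th1 th2)).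
Proof. by case: c; split=> //= -[|n] //=; case: (vr th1 n). Qed.

Lemma compat_up c th1 th2 :
  compat th1 th2 -> compat (up_env c th1) (up_env c th2).
Proof. by case: c => H [|n] //= /H. Qed.

Section RComp.
Variables th1 th2 : env.
Implicit Types R : seq res.

Lemma rcomp_nil_inv R1 R2 R :
  rcomp th1 th2 R1 R2 R -> R = [::] -> R1 = [::] /\ R2 = [::].
Proof.
elim=> // {R1 R2 R} R1 R1' R2 R2' R R' p1 p2 p _ IH E.
move: p; rewrite E => /perm_nilE/IH[E1 E2]; rewrite {}E1 {}E2 in p1 p2.
by split; apply: perm_nilE; rewrite perm_sym.
Qed.

Lemma rcomp_cat R1a R2a Ra R1b R2b Rb :
  rcomp th1 th2 R1a R2a Ra -> rcomp th1 th2 R1b R2b Rb ->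
  rcomp th1 th2 (R1a ++ R1b) (R2a ++ R2b) (Ra ++ Rb).
Proof.
move=> H Hb; elim: H => //= {R1a R2a Ra}.
- by move=> k v w P R1 R2 R Hk Hv _ IH; rewrite -catA; exact: rcomp_fst.
- by move=> k k' w R1 R2 R Hk Hk' _ IH; exact: rcomp_snd Hk' IH.
- move=> R1 R1' R2 R2' R R' p1 p2 p _ IH.
  by apply: rcomp_perm IH; rewrite perm_cat2r.
Qed.

(** Each resource of the composite accounts for its own share of [R1] and [R2], so a splitting of
    the composite separates the shares. *)
Lemma rcomp_split R1 R2 R : rcomp th1 th2 R1 R2 R ->
  forall Ra Rb, perm_eq R (Ra ++ Rb) -> exists R1a R1b R2a R2b,
  [/\ perm_eq R1 (R1a ++ R1b), perm_eq R2 (R2a ++ R2b),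
      rcomp th1 th2 R1a R2a Ra & rcomp th1 th2 R1b R2b Rb].
Proof.
elim=> {R1 R2 R}.
- move=> Ra Rb; rewrite perm_sym => /perm_nilE.
  by case: Ra Rb => [|//] [|//] _; exists [::], [::], [::], [::]; split=> //;
     exact: rcomp_nil.
- move=> k v w P R1 R2 R Hk Hv H IH Ra Rb /perm_cons_cat_inv[[Ra' pa pR]|[Rb' pb pR]].
    have [R1a [R1b [R2a [R2b [p1 p2 Ha Hb]]]]] := IH _ _ pR.
    exists ((k, v) :: R1a), R1b, (P ++ R2a), R2b; split=> //=.
      by rewrite perm_cons.
      by rewrite -catA perm_cat2l.
    by apply: rcomp_perm (rcomp_fst Hk Hv Ha) => //; rewrite perm_sym.
  have [R1a [R1b [R2a [R2b [p1 p2 Ha Hb]]]]] := IH _ _ pR.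
  exists R1a, ((k, v) :: R1b), R2a, (P ++ R2b); split=> //=.
    by rewrite perm_sym -cat1s perm_catCA perm_cons perm_sym.
    by rewrite perm_sym perm_catCA perm_cat2l perm_sym.
  by apply: rcomp_perm (rcomp_fst Hk Hv Hb) => //; rewrite perm_sym.
- move=> k k' w R1 R2 R Hk Hk' H IH Ra Rb /perm_cons_cat_inv[[Ra' pa pR]|[Rb' pb pR]].
    have [R1a [R1b [R2a [R2b [p1 p2 Ha Hb]]]]] := IH _ _ pR.
    exists R1a, R1b, ((k', w) :: R2a), R2b; split=> //=.
      by rewrite perm_cons.
    by apply: rcomp_perm (rcomp_snd w Hk Hk' Ha) => //; rewrite perm_sym.
  have [R1a [R1b [R2a [R2b [p1 p2 Ha Hb]]]]] := IH _ _ pR.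
  exists R1a, R1b, R2a, ((k', w) :: R2b); split=> //=.
    by rewrite perm_sym -cat1s perm_catCA perm_cons perm_sym.
  by apply: rcomp_perm (rcomp_snd w Hk Hk' Hb) => //; rewrite perm_sym.
- move=> R1 R1' R2 R2' R R' p1 p2 p _ IH Ra Rb pR.
  have [R1a [R1b [R2a [R2b [q1 q2 Ha Hb]]]]] := IH _ _ (perm_trans p pR).
  rewrite perm_sym in p1; rewrite perm_sym in p2.
  exists R1a, R1b, R2a, R2b; split=> //; first exact: perm_trans p1 q1.
  exact: perm_trans p2 q2.
Qed.

Lemma keyed_perm_cons_inv k k' w R B :
  perm_eq ((k', w) :: R) (keyed k B) ->
  k' = k /\ exists2 B', perm_eq B (w :: B') & perm_eq R (keyed k B').
Proof.
move=> /perm_map_inv[[|x s] // p [-> -> ->]]; split=> //.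
by exists s.
Qed.

(** An active key excludes [rcomp_snd]: every resource comes from the first action, and all of [R2]
    has been spent inside them. *)
Lemma rcomp_keyed_fst_inv R1 R2 R : rcomp th1 th2 R1 R2 R ->
  forall k B, active th1 k -> perm_eq R (keyed k B) ->
  exists2 B0, perm_eq R1 (keyed k B0) & acts th2 B0 R2 B.
Proof.
elim=> {R1 R2 R}.
- move=> k B _; rewrite perm_sym => /perm_nilE; case: B => // _.
  by exists [::].
- move=> k v w P R1 R2 R _ Hv _ IH k0 B Hk0 /keyed_perm_cons_inv[-> [B' pB pR]].
  have [B0 p0 H0] := IH _ _ Hk0 pR.
  have H1 : acts th2 (v :: B0) (P ++ R2) (w :: B') by exists P, R2; split.
  have [B1 pB1 H] := bag_rel_perm_out H1 pB.
  exists B1 => //; rewrite perm_sym; apply: (perm_trans (y := keyed k0 (v :: B0))).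
    by apply: keyed_perm; rewrite perm_sym.
  by rewrite /= perm_cons perm_sym.
- move=> k k' w R1 R2 R Hk _ _ _ k0 B Hk0 /keyed_perm_cons_inv[Ek _].
  by rewrite Ek in Hk; rewrite (key_image_active Hk) in Hk0.
- move=> R1 R1' R2 R2' R R' p1 p2 p _ IH k B Hk pR.
  have [B0 p0 H0] := IH _ _ Hk (perm_trans p pR).
  exists B0; last exact: bag_rel_perm H0.
  by rewrite perm_sym in p1; exact: perm_trans p1 p0.
Qed.

Lemma rcomp_keyed_snd_inv R1 R2 R : rcomp th1 th2 R1 R2 R ->
  forall k k' B, key_image th1 k = Some k' -> perm_eq R (keyed k B) ->
  R1 = [::] /\ perm_eq R2 (keyed k' B).
Proof.
elim=> {R1 R2 R}.
- by move=> k k' B _; rewrite perm_sym => /perm_nilE; case: B.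
- move=> k v w P R1 R2 R Hk _ _ _ k0 k' B Hk0 /keyed_perm_cons_inv[Ek _].
  by rewrite -Ek in Hk0; rewrite (key_image_active Hk0) in Hk.
- move=> k k' w R1 R2 R Hk _ _ IH k0 k1 B Hk0 /keyed_perm_cons_inv[Ek [B' pB pR]].
  have [-> p2] := IH _ _ _ Hk0 pR; split=> //.
  move: Hk; rewrite Ek Hk0 => -[<-]; rewrite perm_sym.
  by apply: (perm_trans (keyed_perm _ pB)); rewrite /= perm_cons perm_sym.
- move=> R1 R1' R2 R2' R R' p1 p2 p _ IH k k' B Hk pR.
  have [E q2] := IH _ _ _ Hk (perm_trans p pR).
  rewrite E perm_sym in p1; split; first exact: perm_nilE.
  by rewrite perm_sym in p2; exact: perm_trans p2 q2.
Qed.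

Lemma rcomp_keyed_fst k B0 R2 B :
  active th1 k -> acts th2 B0 R2 B -> rcomp th1 th2 (keyed k B0) R2 (keyed k B).
Proof.
move=> Hk; elim: B0 R2 B => [|v B0 IH] R2 [|w B] //=.
  by move=> ->; exact: rcomp_nil.
move=> [P [R [pR Hv /IH H]]]; apply: rcomp_perm (rcomp_fst Hk Hv H) => //.
by rewrite perm_sym.
Qed.

Lemma rcomp_keyed_snd k k' B :
  key_image th1 k = Some k' -> active th2 k' ->
  rcomp th1 th2 [::] (keyed k' B) (keyed k B).
Proof.
move=> Hk Hk'; elim: B => [|w B IH] /=; first exact: rcomp_nil.
exact: rcomp_snd.
Qed.

Lemma active_up c k : active (up_env c th1) (shift_key c k) = active th1 k.
Proof. by case: c; case: k => //= n; case: (vr th1 n). Qed.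

Lemma key_image_up c k :
  key_image (up_env c th1) (shift_key c k) = omap (shift_key c) (key_image th1 k).
Proof.
by case: c; case: k => //= n; [case: (vr th1 n)|case: (na th1 n)|
   case: (vr th1 n)|case: (na th1 n)].
Qed.

End RComp.

Lemma shift_key_inj c : injective (shift_key c).
Proof. by case: c => -[m|m] [n|n] //= []; move=> ->. Qed.

Lemma key_image_up_inv th c k k' :
  key_image (up_env c th) k = Some (shift_key c k') ->
  exists2 k0, k = shift_key c k0 & key_image th k0 = Some k'.
Proof.
case: c k => -[n|n] /=.
- case: n => [|n] /=; first by case: k' => // ? [].
  case Em: (vr th n) => [m|] //= [] Hk'.
  exists (inl n) => //=; rewrite Em /=; congr Some.
  exact: (@shift_key_inj true).
- case Hn: (na th n) => // -[] Hk'.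
  exists (inr n) => //=; rewrite Hn; congr Some.
  exact: (@shift_key_inj true).
- case Em: (vr th n) => [m|] //= [] Hk'.
  exists (inl n) => //=; rewrite Em /=; congr Some.
  exact: (@shift_key_inj false).
- case: n => [|n] /=; first by case: k' => // ? [].
  case Hn: (na th n) => // -[] Hk'.
  exists (inr n) => //=; rewrite Hn; congr Some.
  exact: (@shift_key_inj false).
Qed.

Lemma rcomp_lift c th1 th2 R1 R2 R : rcomp th1 th2 R1 R2 R ->
  rcomp (up_env c th1) (up_env c th2)
    (lift_res c R1) (lift_res c R2) (lift_res c R).
Proof.
elim=> {R1 R2 R} /=; first exact: rcomp_nil.
- move=> k v w P R1 R2 R Hk Hv _ IH; rewrite lift_res_cat.
  by apply: rcomp_fst IH; [rewrite active_up | exact: act_shift].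
- move=> k k' w R1 R2 R Hk Hk' _ IH.
  by apply: rcomp_snd IH; rewrite ?key_image_up ?Hk ?active_up.
- move=> R1 R1' R2 R2' R R' p1 p2 p _ IH.
  by apply: rcomp_perm IH; exact: lift_res_perm.
Qed.

(** Composing under a binder yields resources that still have to be recognised as lifted. The new
    index 0 is sent to 0, never to a lifted key, so [rcomp_snd] contributes lifted keys only;
    [act_shift_inv] lowers the payloads of the other resources. *)
Lemma rcomp_unlift c th1 th2 S1 S2 S :
  rcomp (up_env c th1) (up_env c th2) S1 S2 S ->
  forall R1 R2, perm_eq S1 (lift_res c R1) -> perm_eq S2 (lift_res c R2) ->
  exists2 R, perm_eq S (lift_res c R) & rcomp th1 th2 R1 R2 R.
Proof.
elim=> {S1 S2 S}.
- move=> R1 R2; rewrite !(perm_sym [::]) => /perm_nilE + /perm_nilE.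
  by case: R1 R2 => [|//] [|//] _ _; exists [::] => //; exact: rcomp_nil.
- move=> k v w P S1 S2 S Hk Hv _ IH R1 R2.
  move=> /perm_map_inv[[|[k0 v0] R1'] // p1 [Ek Ev E1]].
  rewrite perm_sym => /perm_map_cat_inv[P0 [R2' [p2 EP E2]]].
  subst k v S1 P S2; have [w0 -> Hw] := act_shift_inv Hv.
  have [||R pR HR] := IH R1' R2'; rewrite ?perm_refl //.
  exists ((k0, w0) :: R); first by rewrite /= perm_cons.
  rewrite active_up in Hk; apply: rcomp_perm (rcomp_fst Hk Hw HR) => //;
    by rewrite perm_sym.
- move=> k k' w S1 S2 S Hk Hk' _ IH R1 R2 p1.
  move=> /perm_map_inv[[|[k0 w0] R2'] // p2 [Ek Ev E2]]; subst k' w S2.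
  have [k1 Ek1 Hk1] := key_image_up_inv Hk; subst k.
  have [|R pR HR] := IH _ R2' p1; rewrite ?perm_refl //.
  exists ((k1, w0) :: R); first by rewrite /= perm_cons.
  rewrite active_up in Hk'.
  by apply: rcomp_perm (rcomp_snd w0 Hk1 Hk' HR) => //; rewrite perm_sym.
- move=> S1 S1' S2 S2' S S' p1 p2 p _ IH R1 R2 q1 q2.
  have [R pR HR] := IH _ _ (perm_trans p1 q1) (perm_trans p2 q2).
  by exists R => //; rewrite perm_sym in p; exact: perm_trans p pR.
Qed.

(** Named apart so that the case of named terms follows from the assumption on the body alone, and
    serves both inside the induction on terms and after it. *)
Definition composable t := forall th1 th2 R1 R2 u w,
  compat th1 th2 -> act t th1 R1 u -> act u th2 R2 w ->
  exists2 R, rcomp th1 th2 R1 R2 R & act t (env_comp th1 th2) R w.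

Definition decomposable t := forall th1 th2 R1 R2 R w,
  compat th1 th2 -> rcomp th1 th2 R1 R2 R -> act t (env_comp th1 th2) R w ->
  exists2 u, act t th1 R1 u & act u th2 R2 w.

(** By compatibility at most one of the two actions gives a bag to the named subterm. A bag from the
    first has then been acted upon by the second ([rcomp_fst]); a bag from the second is taken over
    unchanged ([rcomp_snd]). *)
Lemma nact_comp_of t b th1 th2 R1 R2 c u d w : composable t ->
  compat th1 th2 -> nact b t th1 R1 c u -> nact c u th2 R2 d w ->
  exists2 R, rcomp th1 th2 R1 R2 R & nact b t (env_comp th1 th2) R d w.
Proof.
move=> Ht C [-> H1] [-> H2].
suff [R HR H] : exists2 R, rcomp th1 th2 R1 R2 R &
  if na th1 b || na th2 (nr th1 b) then
    exists R1 B u', [/\ w = PApp u' B, perm_eq R (R1 ++ keyed (inr b) B) &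
      act t (env_comp th1 th2) R1 u']
  else act t (env_comp th1 th2) R w by exists R.
move: H1 H2; case Hb: (na th1 b) => /=.
  rewrite (negPf (C _ Hb)) => -[S1 [B [u' [-> p1 H1]]]] /=.
  move=> [w' [ws [P0 [P1 [-> p2 H0 HB]]]]].
  have [S HS H] := Ht _ _ _ _ _ _ C H1 H0.
  have HB' : rcomp th1 th2 (keyed (inr b) B) P1 (keyed (inr b) ws).
    exact: rcomp_keyed_fst.
  exists (S ++ keyed (inr b) ws); last by exists S, ws, w'.
  by apply: rcomp_perm (rcomp_cat HS HB') => //; rewrite perm_sym.
case Hb': (na th2 (nr th1 b)) => H1 H2; last first.
  by have [S HS H] := Ht _ _ _ _ _ _ C H1 H2; exists S.
move: H2 => [P [B [w' [-> p H2]]]].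
have [S HS H] := Ht _ _ _ _ _ _ C H1 H2.
have HB : rcomp th1 th2 [::] (keyed (inr (nr th1 b)) B) (keyed (inr b) B).
  by apply: rcomp_keyed_snd => //=; rewrite Hb.
exists (S ++ keyed (inr b) B); last by exists S, B, w'.
by apply: rcomp_perm (rcomp_cat HS HB); rewrite ?cats0 // perm_sym.
Qed.

Lemma nact_decomp_of t b th1 th2 R1 R2 R d w : decomposable t ->
  compat th1 th2 -> rcomp th1 th2 R1 R2 R ->
  nact b t (env_comp th1 th2) R d w ->
  exists c u, nact b t th1 R1 c u /\ nact c u th2 R2 d w.
Proof.
move=> Ht C HR [-> H].
suff [u [H1 H2]] : exists u,
   (if na th1 b then exists S B u', [/\ u = PApp u' B,
       perm_eq R1 (S ++ keyed (inr b) B) & act t th1 S u']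
    else act t th1 R1 u) /\
   (if na th2 (nr th1 b) then exists S B u', [/\ w = PApp u' B,
       perm_eq R2 (S ++ keyed (inr (nr th1 b)) B) & act u th2 S u']
    else act u th2 R2 w).
  by exists (nr th1 b), u.
move: H => /=; case Hb: (na th1 b) => /=.
  rewrite (negPf (C _ Hb)) => -[S [B [w' [-> p H]]]].
  have [R1a [R1b [R2a [R2b [p1 p2 Ha HB]]]]] := rcomp_split HR p.
  have [u' H1 H2] := Ht _ _ _ _ _ _ C Ha H.
  have [B0 pB0 HB0] :=
    rcomp_keyed_fst_inv (k := inr b) HB Hb (perm_refl _).
  exists (PApp u' B0); split.
    exists R1a, B0, u'; split=> //; apply: (perm_trans p1).
    by rewrite perm_cat2l.
  by exists w', B, R2a, R2b.
case Hb': (na th2 (nr th1 b)) => H; last first.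
  by have [u H1 H2] := Ht _ _ _ _ _ _ C HR H; exists u.
move: H => [S [B [w' [-> p H]]]].
have [R1a [R1b [R2a [R2b [p1 p2 Ha HB]]]]] := rcomp_split HR p.
have [u' H1 H2] := Ht _ _ _ _ _ _ C Ha H.
have Hk : key_image th1 (inr b) = Some (inr (nr th1 b)) by rewrite /= Hb.
have [E pB] := rcomp_keyed_snd_inv HB Hk (perm_refl _).
exists u'; split; first by apply: act_perm H1; rewrite E cats0 perm_sym in p1.
exists R2a, B, w'; split=> //; apply: (perm_trans p2).
by rewrite perm_cat2l.
Qed.

Lemma act_comp t : composable t.
Proof.
elim/pterm_ind_in: t => [n|t IH|t vs IHt IH|b t IH] th1 th2 R1 R2 u w C /=.
- case E: (vr th1 n) => [m|] /=; last first.
    move=> -> H; exists [:: (inl n, w)] => //.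
    rewrite -[R2]cats0; apply: rcomp_fst H _; last exact: rcomp_nil.
    by rewrite /= E.
  move=> [-> ->] /=; case E': (vr th2 m) => [l|] H.
    by case: H => -> ->; exists [::] => //; exact: rcomp_nil.
  rewrite H; exists [:: (inl n, w)] => //.
  apply: rcomp_snd (rcomp_nil _ _); first by rewrite /= E.
  by rewrite /= E'.
- move=> [u' -> H1] [w' -> H2].
  have [S HS H] := IH _ _ _ _ _ _ (compat_up (c := true) C) H1 H2.
  have [R pR HR] := rcomp_unlift HS (perm_refl _) (perm_refl _).
  exists R => //; exists w' => //.
  exact: act_perm pR (act_ext (env_comp_up _ _ _) H).
- move=> [u' [us [P0 [P1 [-> p1 H1 HB1]]]]] [w' [ws [Q0 [Q1 [-> p2 H2 HB2]]]]].
  have [R HR H] := IHt _ _ _ _ _ _ C H1 H2.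
  suff [S HS HB] : exists2 S, rcomp th1 th2 P1 Q1 S &
      acts (env_comp th1 th2) vs S ws.
    exists (R ++ S); last by exists w', ws, R, S.
    by apply: rcomp_perm (rcomp_cat HR HS) => //; rewrite perm_sym.
  move: HB1 HB2 IH C; clear=> HB1 HB2 IH C; move: HB1 HB2 IH.
  elim: vs us ws P1 Q1 => [|v vs IHvs] [|u us] [|w ws] P1 Q1 //=.
    by move=> -> -> _; exists [::] => //; exact: rcomp_nil.
  move=> [A0 [A1 [pA Hv Hvs]]] [B0 [B1 [pB Hu Hus]]] IH.
  have [R HR H] := IH _ (mem_head _ _) _ _ _ _ _ _ C Hv Hu.
  have [|S HS HB] := IHvs _ _ _ _ Hvs Hus.
    by move=> x xin; apply: IH; rewrite inE xin orbT.
  exists (R ++ S); last by exists R, S.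
  by apply: rcomp_perm (rcomp_cat HR HS) => //; rewrite perm_sym.
- move=> [c [u' [-> H1]]] [d [w' [-> H2]]].
  have [S HS H] := nact_comp_of IH (compat_up (c := false) C) H1 H2.
  have [R pR HR] := rcomp_unlift HS (perm_refl _) (perm_refl _).
  exists R => //; exists d, w'; split=> //.
  exact: nact_perm pR (nact_ext (env_comp_up _ _ _) H).
Qed.

(** [rcomp_split] distributes the two resource lists along the term in the same way as the
    composite. At a variable, its status under [th1] decides which of the two actions spends the
    resource. *)
Lemma act_decomp t : decomposable t.
Proof.
have eq_env_sym th th' : eq_env th th' -> eq_env th' th.
  by move=> [? ? ?]; split; exact: fsym.
elim/pterm_ind_in: t => [n|t IH|t vs IHt IH|b t IH] th1 th2 R1 R2 R w C HR /=.
- case E: (vr th1 n) => [m|] /=; last first.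
    move=> ER; have Hn : active th1 (inl n) by rewrite /= E.
    have := rcomp_keyed_fst_inv (B := [:: w]) HR Hn.
    rewrite ER => /(_ (perm_refl _))[[|v [|v' B0]] p] //=; last first.
      by move=> [? [? [? ?]]].
    move=> [P0 [P1 [pP Hv EP]]]; exists v.
      by apply: perm_small_eq.
    by apply: act_perm Hv; rewrite EP cats0 perm_sym in pP.
  case E': (vr th2 m) => [l|].
    move=> [ER ->]; have [-> ->] := rcomp_nil_inv HR ER.
    by exists (PVar m); rewrite /= ?E'.
  move=> ER; have Hn : key_image th1 (inl n) = Some (inl m) by rewrite /= E.
  have := rcomp_keyed_snd_inv (B := [:: w]) HR Hn.
  rewrite ER => /(_ (perm_refl _))[-> p].
  exists (PVar m) => //=; rewrite E'; exact: perm_small_eq.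
- move=> [w' -> H].
  have [u H1 H2] := IH _ _ _ _ _ _ (compat_up (c := true) C) (rcomp_lift true HR)
    (act_ext (eq_env_sym _ _ (env_comp_up true th1 th2)) H).
  by exists (PLam u); [exists u | exists w'].
- move=> [w' [ws [P0 [P1 [-> p H HB]]]]].
  have [R1a [R1b [R2a [R2b [p1 p2 Ha Hb]]]]] := rcomp_split HR p.
  have [u Hu1 Hu2] := IHt _ _ _ _ _ _ C Ha H.
  suff [us HB1 HB2] : exists2 us, acts th1 vs R1b us & acts th2 us R2b ws.
    by exists (PApp u us); [exists u, us, R1a, R1b | exists w', ws, R2a, R2b].
  move: HB Hb IH C; clear=> HB Hb IH C; move: HB Hb IH.
  elim: vs ws R1b R2b P1 => [|v vs IHvs] [|w ws] R1 R2 P //=.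
    by move=> EP HR _; have [-> ->] := rcomp_nil_inv HR EP; exists [::].
  move=> [A0 [A1 [pA Hv Hvs]]] HR IH.
  have [R1a [R1b [R2a [R2b [p1 p2 Ha Hb]]]]] := rcomp_split HR pA.
  have [u Hu1 Hu2] := IH _ (mem_head _ _) _ _ _ _ _ _ C Ha Hv.
  have [|us HB1 HB2] := IHvs _ _ _ _ Hvs Hb.
    by move=> x xin; apply: IH; rewrite inE xin orbT.
  by exists (u :: us); [exists R1a, R1b | exists R2a, R2b].
- move=> [d [w' [-> H]]].
  have [c [u [H1 H2]]] := nact_decomp_of IH (compat_up (c := false) C)
    (rcomp_lift false HR) (nact_ext (eq_env_sym _ _ (env_comp_up false th1 th2)) H).
  by exists (PMu c u); [exists c, u | exists d, w'].
Qed.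

Lemma nact_comp t b th1 th2 R1 R2 c u d w :
  compat th1 th2 -> nact b t th1 R1 c u -> nact c u th2 R2 d w ->
  exists2 R, rcomp th1 th2 R1 R2 R & nact b t (env_comp th1 th2) R d w.
Proof. exact/nact_comp_of/act_comp. Qed.

Lemma nact_decomp t b th1 th2 R1 R2 R d w :
  compat th1 th2 -> rcomp th1 th2 R1 R2 R ->
  nact b t (env_comp th1 th2) R d w ->
  exists c u, nact b t th1 R1 c u /\ nact c u th2 R2 d w.
Proof. exact/nact_decomp_of/act_decomp. Qed.

(** For a redex with bag [B] followed by an action: [P] is what the action spends inside the bag,
    turning it into [B'], and [L] is what it spends on the body, each resource listed with its key
    before and after the first action. *)
Lemma rcomp_keyed_inv th1 th2 R1 R2 R : rcomp th1 th2 R1 R2 R ->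
  forall k B, perm_eq R1 (keyed k B) ->
  exists P B' (L : seq (key * key * pterm)),
  [/\ perm_eq R2 (P ++ [seq (x.1.2, x.2) | x <- L]),
      perm_eq R (keyed k B' ++ [seq (x.1.1, x.2) | x <- L]),
      acts th2 B P B' &
      forall x, x \in L -> key_image th1 x.1.1 = Some x.1.2 /\ active th2 x.1.2].
Proof.
elim=> {R1 R2 R}.
- move=> k B; rewrite perm_sym => /perm_nilE; case: B => // _.
  by exists [::], [::], [::].
- move=> k0 v w P R1 R2 R _ Hv _ IH k B /keyed_perm_cons_inv[-> [B1 pB pR]].
  have [P1 [B1' [L [p2 p H HL]]]] := IH _ _ pR.
  have H1 : acts th2 (v :: B1) (P ++ P1) (w :: B1') by exists P, P1; split.
  have [B' pB' H'] := bag_rel_perm_in H1 pB.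
  exists (P ++ P1), B', L; split=> //; first by rewrite -catA perm_cat2l.
  apply: (perm_trans (y := keyed k (w :: B1') ++ [seq (x.1.1, x.2) | x <- L])).
    by rewrite /= perm_cons.
  by rewrite perm_cat2r; exact: keyed_perm.
- move=> k0 k1 w R1 R2 R Hk Hk' _ IH k B pR.
  have [P [B' [L [p2 p H HL]]]] := IH _ _ pR.
  exists P, B', ((k0, k1, w) :: L); split=> //.
  + by rewrite /= perm_sym -cat1s perm_catCA perm_cons perm_sym.
  + by rewrite /= perm_sym -cat1s perm_catCA perm_cons perm_sym.
  + by move=> x; rewrite inE => /orP[/eqP->|/HL].
- move=> R1 R1' R2 R2' R R' p1 p2 p _ IH k B pR.
  have [P [B' [L [q2 q H HL]]]] := IH _ _ (perm_trans p1 pR).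
  rewrite perm_sym in p2; rewrite perm_sym in p.
  exists P, B', L; split=> //; first exact: perm_trans p2 q2.
  exact: perm_trans p q.
Qed.

Lemma rcomp_fst_map (T : eqType) th1 th2 (L : seq T) (k : T -> key) v w :
  (forall x, x \in L -> active th1 (k x) /\ act (v x) th2 [::] (w x)) ->
  rcomp th1 th2 [seq (k x, v x) | x <- L] [::] [seq (k x, w x) | x <- L].
Proof.
elim: L => [|x L IH] H /=; first exact: rcomp_nil.
have [Hk Hv] := H _ (mem_head _ _).
have := rcomp_fst Hk Hv; apply; apply: IH => y yin.
by apply: H; rewrite inE yin orbT.
Qed.

Lemma rcomp_join th1 th2 R1 R2 Ra Rb :
  rcomp th1 th2 [::] R2 Ra -> rcomp th1 th2 R1 [::] Rb ->
  rcomp th1 th2 R1 R2 (Ra ++ Rb).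
Proof. by move=> Ha Hb; rewrite -[R2]cats0; exact: rcomp_cat Ha Hb. Qed.

(** * Reduction of pre-terms and its exchange with actions *)

Definition subst_env k :=
  Env (fun n => if n == k then None else Some (if k < n then n.-1 else n))
      id (fun=> false).

Definition name_env a := Env (fun n => Some n) id (fun n => n == a).

Definition ren_env f g := Env (fun n => Some (f n)) g (fun=> false).

(** A beta-step removes its binder, so the bag already lives in the context of the result. A mu-step
    keeps its binder, hence the shift in [mu_to]. *)
Definition beta_to r B u := act r (subst_env 0) (keyed (inl 0) B) u.

Definition mu_to b r B c u :=
  nact b r (name_env 0) (keyed (inr 0) (map (shift false) B)) c u.

Lemma act_ren_env t f g u : act t (ren_env f g) [::] u <-> u = pren f g t.
Proof.
split; last first.
  move=> ->; have := @act_pren t (ren_env f g) id id f g.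
  by rewrite pren_id; exact.
suff H : forall th R, R = [::] -> (forall n, vr th n = Some (f n)) ->
    nr th =1 g -> (forall n, na th n = false) -> act t th R u -> u = pren f g t.
  by apply: H.
elim/pterm_ind_in: t f g u => [n|t IH|t vs IHt IH|b t IH] f g u th R -> Hv Hr Ha /=.
- by rewrite Hv => -[].
- move=> [u' -> H]; congr PLam; apply: IH H => //.
  by case=> [|n] //=; rewrite Hv.
- move=> [u' [us [R0 [R1 [->]]]]]; rewrite perm_sym => /perm_nilE.
  case: R0 R1 => [|//] [|//] _ Ht H; congr PApp; first exact: IHt Ht.
  elim: vs us H IH => [|v vs IHvs] [|w us] //= [R0 [R1 []]].
  rewrite perm_sym => /perm_nilE.
  case: R0 R1 => [|//] [|//] _ Hw Hus IH.
  rewrite (IH _ (mem_head _ _) f g _ _ _ _ _ _ _ Hw) // (IHvs _ Hus) // => x xin.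
  by apply: IH; rewrite inE xin orbT.
- move=> [c [u' [-> [-> ]]]].
  have Hr' : nr (up_env false th) =1 up_ren g by case=> [|n] //=; rewrite Hr.
  have Ha' n : na (up_env false th) n = false by case: n => //= n; rewrite Ha.
  by rewrite Ha' Hr' => H; congr PMu; apply: IH H.
Qed.

Lemma nact_ren_env b t f g c u :
  nact b t (ren_env f g) [::] c u <-> c = g b /\ u = pren f g t.
Proof. by split=> [[-> /act_ren_env->] //|[-> ->]]; split=> //; apply/act_ren_env. Qed.

Lemma acts_shift_inv c B th R W :
  acts (up_env c th) (map (shift c) B) (lift_res c R) W ->
  exists2 B', W = map (shift c) B' & acts th B R B'.
Proof.
elim: B R W => [|v B IH] R [|w W] //=; first by case: R => // _; exists [::].
move=> [R0 [R1 [/perm_map_cat_inv[S0 [S1 [p E0 E1]]] Hv Hvs]]].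
move: Hv Hvs; rewrite -E0 -E1 => /act_shift_inv[u -> Hu] /IH[B' -> HB].
by exists (u :: B') => //; exists S0, S1.
Qed.

(** The target is one summand of the reduct: a thread follows single terms, so sums are absent. *)
Inductive step : pterm -> pterm -> Prop :=
  | step_beta r B u : beta_to r B u -> step (PApp (PLam r) B) u
  | step_mu b r B c u : mu_to b r B c u -> step (PApp (PMu b r) B) (PMu c u)
  | step_rho a e r :
      step (PMu a (PMu e r)) (PMu (nsubst a e) (pren id (nsubst a) r))
  | step_in_lam t u : step t u -> step (PLam t) (PLam u)
  | step_in_fun t u vs : step t u -> step (PApp t vs) (PApp u vs)
  | step_in_arg t v w vs vs' :
      step v w -> step (PApp t (vs ++ v :: vs')) (PApp t (vs ++ w :: vs'))
  | step_in_mu b t u : step t u -> step (PMu b t) (PMu b u).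

Definition steps := clos_refl_trans pterm step.

Lemma clos_rt_map (T U : Type) (R : T -> T -> Prop) (S : U -> U -> Prop) f x y :
  (forall x y, R x y -> S (f x) (f y)) ->
  clos_refl_trans T R x y -> clos_refl_trans U S (f x) (f y).
Proof.
move=> H; elim=> {x y} [x y /H|x|x y z _ IH1 _ IH2]; first exact: rt_step.
  exact: rt_refl.
exact: rt_trans IH1 IH2.
Qed.

Lemma steps_lam t u : steps t u -> steps (PLam t) (PLam u).
Proof. apply: clos_rt_map; exact: step_in_lam. Qed.

Lemma steps_fun t u vs : steps t u -> steps (PApp t vs) (PApp u vs).
Proof. by apply: (clos_rt_map (f := fun t => PApp t vs)) => *; exact: step_in_fun. Qed.

Lemma steps_arg t v w vs vs' : steps v w ->
  steps (PApp t (vs ++ v :: vs')) (PApp t (vs ++ w :: vs')).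
Proof.
by apply: (clos_rt_map (f := fun v => PApp t (vs ++ v :: vs'))) => *;
  exact: step_in_arg.
Qed.

Lemma steps_mu b t u : steps t u -> steps (PMu b t) (PMu b u).
Proof. apply: clos_rt_map; exact: step_in_mu. Qed.

Lemma bag_rel_mid P vs v vs' R us :
  bag_rel P (vs ++ v :: vs') R us <->
  exists us1 u us2 R0 R1,
    [/\ us = us1 ++ u :: us2, size us1 = size vs, perm_eq R (R0 ++ R1),
        P v R0 u & bag_rel P (vs ++ vs') R1 (us1 ++ us2)].
Proof.
split.
  elim: vs R us => [|x vs IH] R [|y us] //=.
    by move=> [R0 [R1 [p Hv Hvs]]]; exists [::], y, us, R0, R1.
  move=> [R0 [R1 [p Hx /IH[us1 [u [us2 [S0 [S1 [-> E q Hv Hvs]]]]]]]]].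
  exists (y :: us1), u, us2, S0, (R0 ++ S1); split=> //=; first by rewrite E.
    by apply: (perm_trans p); rewrite perm_sym perm_catCA perm_cat2l perm_sym.
  by exists R0, S1.
move=> [us1 [u [us2 [R0 [R1 [-> E p Hv H]]]]]].
elim: vs us1 R R1 E p H => [|x vs IH] [|y us1] R R1 //= => [|[E]] p.
  by move=> H; exists R0, R1.
move=> [S0 [S1 [q Hx H]]]; exists S0, (R0 ++ S1); split=> //; last first.
  exact: IH H.
apply: (perm_trans p); rewrite perm_sym perm_catCA perm_cat2l perm_sym //.
Qed.

(** The substitution followed by the action of [th] is one action by [act_comp]; [act_decomp] then
    performs the action of [th], lifted, before the substitution. [P] goes to the bag and [S] to the
    body. *)
Lemma act_step_beta r B t1 th R q :
  beta_to r B t1 -> act t1 th R q ->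
  exists q', act (PApp (PLam r) B) th R q' /\ step q' q.
Proof.
move=> H Hq; have C : compat (subst_env 0) th by [].
have [R' HR Hr] := act_comp C H Hq.
have [P [B' [L [p2 p HB HL]]]] := rcomp_keyed_inv HR (perm_refl _).
have HL' x : x \in L -> x.1.1 = shift_key true x.1.2 /\ active th x.1.2.
  move=> /HL[H1 H2]; split=> //; move: H1 {H2}.
  by case: x.1.1 => [[|n]|n] //= [<-].
set S := [seq (x.1.2, x.2) | x <- L] in p2.
have E : eq_env (env_comp (subst_env 0) th)
                (env_comp (up_env true th) (subst_env 0)).
  by split=> [[|n]|n|n] //=; [case: (vr th n) | rewrite orbF].
have C' : compat (up_env true th) (subst_env 0) by [].
have HS : rcomp (up_env true th) (subst_env 0)
    (lift_res true S) (keyed (inl 0) B') R'.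
  rewrite perm_sym in p.
  apply: (rcomp_perm (perm_refl _) (perm_refl _) p).
  (* The bag [B'] belongs to the substitution, now second. The resources spent on the body come
     first; being shifted, they pass through the substitution unchanged. *)
  apply: rcomp_join; first exact: rcomp_keyed_snd.
  rewrite /S /lift_res -map_comp.
  rewrite (_ : [seq (x.1.1, x.2) | x <- L] =
     [seq (shift_key true x.1.2, x.2) | x <- L]); last first.
    by apply/eq_in_map => x /HL'[->].
  apply: (rcomp_fst_map (v := fun x => shift true x.2)) => x /HL'[_ Hx].
  rewrite active_up; split=> //.
  by rewrite -{2}[x.2]pren_id; apply: act_pren.
have [r' Hr1 Hr2] := act_decomp C' HS (act_ext E Hr).
exists (PApp (PLam r') B'); split; last exact: step_beta.
exists (PLam r'), B', S, P; split=> //; first by rewrite perm_sym perm_catC perm_sym.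
by exists r'.
Qed.

Lemma act_step_mu b r B c u th R d q :
  mu_to b r B c u -> act (PMu c u) th R (PMu d q) ->
  exists q', act (PApp (PMu b r) B) th R q' /\ step q' (PMu d q).
Proof.
move=> H [_ [_ [[<- <-] Hq]]].
(* Only the bound name 0 receives the bag of the redex, and a lifted environment never marks it. *)
have C : compat (name_env 0) (up_env false th) by move=> n /= /eqP->.
have [R' HR Hr] := nact_comp C H Hq.
have [P [W [L [p2 p HB HL]]]] := rcomp_keyed_inv HR (perm_refl _).
have [S0 [S1 [pR E0 E1]]] := perm_map_cat_inv p2; subst P.
have [B' EW HB'] := acts_shift_inv HB; subst W.
have EL : [seq (x.1.1, x.2) | x <- L] = lift_res false S1.
  rewrite [RHS]E1; apply/eq_in_map => x /HL[+ _].
  by case: x.1.1 => n /=; [|case: ifP => // _] => -[<-].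
have act1 x : x \in S1 -> active th x.1.
  move=> xin; rewrite -(active_up th false).
  have : shift_res false x \in lift_res false S1 by exact: map_f.
  rewrite [lift_res false S1]E1 => /mapP[y /HL[_ Hy] /(congr1 fst) Ex].
  by rewrite -[shift_key _ _]/((shift_res false x).1) Ex.
have E : eq_env (env_comp (name_env 0) (up_env false th))
                (env_comp (up_env false th) (name_env 0)).
  by split=> [n|n|[|n]] //=; [case: (vr th n) | rewrite orbF].
have C' : compat (up_env false th) (name_env 0) by case.
have HS : rcomp (up_env false th) (name_env 0)
    (lift_res false S1) (keyed (inr 0) (map (shift false) B')) R'.
  rewrite perm_sym in p.
  apply: (rcomp_perm (perm_refl _) (perm_refl _) p).
  apply: rcomp_join; first exact: rcomp_keyed_snd.
  rewrite EL; apply: (rcomp_fst_map (k := fun x => shift_key false x.1)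
    (v := fun x => shift false x.2)) => x xin.
  by rewrite active_up; split; [exact: act1 | apply: act_pren].
have [c' [r' [Hr1 Hr2]]] := nact_decomp C' HS (nact_ext E Hr).
exists (PApp (PMu c' r') B'); split; last exact: step_mu.
exists (PMu c' r'), B', S1, S0; split=> //.
  by rewrite perm_sym perm_catC perm_sym.
by exists c', r'.
Qed.

(** In the reduct the name [a] gathers the former [a] and the former inner bound name. If [th] gives
    bags to [a], the redex receives outside its inner mu the bag of all resources meant for the
    inner name; a mu-step distributes it, and a rho-step then merges the names. *)
Lemma nact_step_rho a e r th R c q :
  nact (nsubst a e) (pren id (nsubst a) r) th R c q ->
  exists c' q', nact a (PMu e r) th R c' q' /\ steps (PMu c' q') (PMu c q).
Proof.
move=> Hq; pose rho a := ren_env id (nsubst a).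
have Hr0 : nact e r (rho a) [::] (nsubst a e) (pren id (nsubst a) r).
  exact/nact_ren_env.
have C : compat (rho a) th by [].
have [R' HR Hr] := nact_comp C Hr0 Hq.
have [P [W [L [p2 p HB HL]]]] :=
  rcomp_keyed_inv (k := inr 0) (B := [::]) HR (perm_refl _).
case: W p HB => //= p EP; rewrite {}EP /= in p2.
(* [L0] holds the resources spent at the inner bound name, which form the bag [B]; [L1] holds those
   spent elsewhere in [r]. *)
pose L0 := [seq x <- L | x.1.1 == inr 0]; pose L1 := [seq x <- L | x.1.1 != inr 0].
have pL : perm_eq L (L0 ++ L1) by rewrite perm_sym; exact/permEl/perm_filterC.
have HL1 x : x \in L1 -> x.1.1 = shift_key false x.1.2 /\ active th x.1.2.
  rewrite mem_filter => /andP[H0 /HL[Hk Hx]]; split=> //.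
  by move: H0 Hk; case: x.1.1 => [n|[|n]] //= _ [<-].
have HL0 x : x \in L0 -> [/\ x.1.1 = inr 0, x.1.2 = inr a & na th a].
  rewrite mem_filter => /andP[/eqP E /HL[Hk Hx]]; move: Hk Hx.
  by rewrite E /= => -[<-].
pose B := [seq x.2 | x <- L0].
pose S := [seq (x.1.2, x.2) | x <- L1].
have EB1 : [seq (x.1.1, x.2) | x <- L0] = keyed (inr 0) B.
  by rewrite /keyed /B -map_comp; apply/eq_in_map => x /HL0[->].
have EB2 : [seq (x.1.2, x.2) | x <- L0] = keyed (inr a) B.
  by rewrite /keyed /B -map_comp; apply/eq_in_map => x /HL0[_ ->].
have p' : perm_eq R' (keyed (inr 0) B ++ [seq (shift_key false x.1.2, x.2) | x <- L1]).
  apply: (perm_trans p); apply: (perm_trans (perm_map _ pL)).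
  rewrite map_cat EB1 perm_cat2l (_ : map _ L1 =
    [seq (shift_key false x.1.2, x.2) | x <- L1]) //.
  by apply/eq_in_map => x /HL1[->].
have pR : perm_eq R (S ++ keyed (inr a) B).
  apply: (perm_trans p2); apply: (perm_trans (perm_map _ pL)).
  by rewrite map_cat EB2 perm_catC.
pose c' := nr th a.
have HS th2 : (forall w, act (shift false w) th2 [::] w) ->
    rcomp (up_env false th) th2 (lift_res false S) [::]
      [seq (shift_key false x.1.2, x.2) | x <- L1].
  move=> Hth2; rewrite /lift_res /S -map_comp.
  apply: (rcomp_fst_map (v := fun x => shift false x.2)) => x /HL1[_ Hx].
  by rewrite active_up.
have Hrho w : act (shift false w) (rho c') [::] w.
  by rewrite -{2}[w]pren_id; apply: act_pren.
case Ha: (na th a); last first.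
  have EB : B = [::].
    rewrite /B; case EL0: L0 => [//|x l].
    by have [] := HL0 x; rewrite ?Ha // EL0 mem_head.
  rewrite EB /= in p' pR; rewrite cats0 in pR.
  have E : eq_env (env_comp (rho a) th) (env_comp (up_env false th) (rho c')).
    by split=> [n|[|n]|[|n]] //=; rewrite ?Ha ?orbF //; case: (vr th n).
  have C' : compat (up_env false th) (rho c') by case.
  have HS' := HS _ Hrho; rewrite perm_sym in p'.
  have {}HS' := rcomp_perm (perm_refl _) (perm_refl _) p' HS'.
  have [e' [r' [Hr1 /nact_ren_env[-> ->]]]] := nact_decomp C' HS' (nact_ext E Hr).
  exists c', (PMu e' r'); split; last exact/rt_step/step_rho.
  split=> //; rewrite Ha; rewrite perm_sym in pR; apply: act_perm pR _.
  by exists e', r'.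
(* The mu-step on the inner name and the renaming of that name, taken as one action; it is
   decomposed again below. *)
pose th2 := env_comp (name_env 0) (rho c').
have E : eq_env (env_comp (rho a) th) (env_comp (up_env false th) th2).
  by split=> [n|[|n]|[|n]] //=; rewrite ?Ha ?orbF //; case: (vr th n).
have C1 : compat (up_env false th) th2 by case.
have C2 : compat (name_env 0) (rho c') by [].
have Hth2 w : act (shift false w) th2 [::] w.
  by rewrite -{2}[w]pren_id; apply: act_pren.
have HS1 : rcomp (up_env false th) th2 (lift_res false S) (keyed (inr 0) B) R'.
  rewrite perm_sym in p'; apply: (rcomp_perm (perm_refl _) (perm_refl _) p').
  by apply: rcomp_join (HS _ Hth2); exact: rcomp_keyed_snd.
have HS2 : rcomp (name_env 0) (rho c')
    (keyed (inr 0) (map (shift false) B)) [::] (keyed (inr 0) B).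
  apply: rcomp_keyed_fst => //; rewrite /acts.
  elim: (B) => //= w B' IH.
  by exists [::], [::]; split=> //; exact: Hrho.
have [e1 [r1 [Hr1 Hr2]]] := nact_decomp C1 HS1 (nact_ext E Hr).
have [e2 [r2 [Hr3 /nact_ren_env[-> ->]]]] := nact_decomp C2 HS2 Hr2.
exists c', (PApp (PMu e1 r1) B); split.
  split=> //; rewrite Ha; exists S, B, (PMu e1 r1); split=> //.
  by exists e1, r1.
apply: (rt_trans _ _ _ (PMu c' (PMu e2 r2))); last exact/rt_step/step_rho.
exact/rt_step/step_in_mu/step_mu.
Qed.

(** The second clause covers the steps inside the mu that a head mu- or rho-redex consumes: the
    environment there acts on the bound name, out of reach of the first clause. The exchange of a
    rho-step is what makes the conclusion a sequence of steps. *)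
Lemma act_nact_step t t1 : step t t1 ->
  (forall th R q, act t1 th R q -> exists q', act t th R q' /\ steps q' q) /\
  (forall b r b1 r1, t = PMu b r -> t1 = PMu b1 r1 ->
   forall th R c q, nact b1 r1 th R c q ->
   exists c' q', nact b r th R c' q' /\ steps (PMu c' q') (PMu c q)).
Proof.
have of_nact b r b1 r1 :
    (forall th R c q, nact b1 r1 th R c q ->
      exists c' q', nact b r th R c' q' /\ steps (PMu c' q') (PMu c q)) ->
    forall th R q, act (PMu b1 r1) th R q ->
      exists q', act (PMu b r) th R q' /\ steps q' q.
  move=> H th R q [c [q1 [-> /H[c' [q' [Hq ?]]]]]].
  by exists (PMu c' q'); split=> //; exists c', q'.
elim=> {t t1}.
- move=> r B u Hu; split=> // th R q /(act_step_beta Hu)[q' [? ?]].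
  by exists q'; split=> //; exact: rt_step.
- move=> b r B c u Hu; split=> // th R q Hq.
  have [d [q1 [Eq _]]] := Hq; rewrite Eq in Hq *.
  have [q' [? ?]] := act_step_mu Hu Hq.
  by exists q'; split=> //; exact: rt_step.
- move=> a e r; split; last by move=> _ _ _ _ [<- <-] [<- <-]; exact: nact_step_rho.
  by apply: of_nact; exact: nact_step_rho.
- move=> t u _ [IH _]; split=> // th R q [q1 -> /IH[q' [H Hs]]].
  by exists (PLam q'); split; [exists q' | exact: steps_lam].
- move=> t u vs _ [IH _]; split=> // th R q.
  move=> [q1 [us [R0 [R1 [-> p /IH[q' [H Hs]] HB]]]]].
  by exists (PApp q' us); split; [exists q', us, R0, R1 | exact: steps_fun].
- move=> t v w vs vs' _ [IH _]; split=> // th R q.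
  move=> [q1 [us [R0 [R1 [-> p Ht /bag_rel_mid]]]]].
  move=> [us1 [x [us2 [S0 [S1 [-> Es pS /IH[y [Hy Hs]] HB]]]]]].
  exists (PApp q1 (us1 ++ y :: us2)); split; last exact: steps_arg.
  exists q1, (us1 ++ y :: us2), R0, R1; split=> //.
  by apply/bag_rel_mid; exists us1, y, us2, S0, S1.
- move=> b t u _ [IH _].
  have Hn th R c q : nact b u th R c q ->
      exists c' q', nact b t th R c' q' /\ steps (PMu c' q') (PMu c q).
    move=> [-> H]; exists (nr th b); rewrite /nact /named_rel.
    move: H; case: (na th b); last first.
      by move=> /IH[q' [? ?]]; exists q'; split=> //; exact: steps_mu.
    move=> [R1 [B [q1 [-> p /IH[q' [? ?]]]]]]; exists (PApp q' B); split.
      by split=> //; exists R1, B, q'.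
    exact/steps_mu/steps_fun.
  split; last by move=> _ _ _ _ [<- <-] [<- <-]; exact: Hn.
  exact: of_nact.
Qed.

Lemma act_steps t t1 th R q : steps t t1 -> act t1 th R q ->
  exists2 q', act t th R q' & steps q' q.
Proof.
move=> H; elim: H R q => {t t1} [t t1 /act_nact_step[H _] R q /H[q' [? ?]]|t R q H|].
- by exists q'.
- by exists q => //; exact: rt_refl.
- move=> t t1 t2 _ IH1 _ IH2 R q /IH2[q2 /IH1[q1 H1 Hs1] Hs2].
  by exists q1 => //; exact: rt_trans Hs1 Hs2.
Qed.

Lemma steps_pren t t1 f g : steps t t1 -> steps (pren f g t) (pren f g t1).
Proof.
move=> H; have H1 : act t1 (ren_env f g) [::] (pren f g t1) by exact/act_ren_env.
by have [q /act_ren_env->] := act_steps H H1.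
Qed.

Lemma steps_shift c t t1 : steps t t1 -> steps (shift c t) (shift c t1).
Proof. by case: c; exact: steps_pren. Qed.

Lemma nact_res_steps_of t th b k v v1 R c q :
  (forall R q, act t th ((k, v1) :: R) q ->
    exists2 q', act t th ((k, v) :: R) q' & steps q' q) ->
  steps v v1 -> nact b t th ((k, v1) :: R) c q ->
  exists2 q', nact b t th ((k, v) :: R) c q' & steps q' q.
Proof.
move=> IH Hs [-> H].
suff [q' Hq Hqs] : exists2 q', if na th b then exists R1 B u',
    [/\ q' = PApp u' B, perm_eq ((k, v) :: R) (R1 ++ keyed (inr b) B) & act t th R1 u']
  else act t th ((k, v) :: R) q' & steps q' q by exists q'.
move: H; case: ifP => _; last exact: IH.
move=> [R1 [B [u [-> /perm_cons_cat_inv[[S p0 p]|[S p1 p]] Ht]]]].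
  have [u' Hu Hus] := IH _ _ (act_perm p0 Ht).
  exists (PApp u' B); last exact: steps_fun.
  by exists ((k, v) :: S), B, u'; split=> //=; rewrite perm_cons.
have : (k, v1) \in keyed (inr b) B by rewrite (perm_mem p1) mem_head.
move=> /mapP[x + [Ek Ex]]; rewrite -Ex => vB {x Ex}.
move: p1; case/path.splitPr: vB => B1 B2 p1.
exists (PApp u (B1 ++ v :: B2)); last exact: steps_arg.
exists R1, (B1 ++ v :: B2), u; split=> //.
have p2 w : perm_eq (keyed (inr b) (B1 ++ w :: B2))
                    ((k, w) :: keyed (inr b) (B1 ++ B2)).
  rewrite Ek; apply: (keyed_perm _ (B' := w :: B1 ++ B2)).
  by rewrite -cat1s perm_catCA.
rewrite (permPr (perm_cat (perm_refl R1) (p2 v))).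
rewrite perm_sym -cat1s perm_catCA perm_cons perm_sym.
apply: (perm_trans p); rewrite perm_cat2l perm_sym.
by rewrite -(perm_cons (k, v1)) -(permPl (p2 v1)).
Qed.

(** By linearity [v1] is placed exactly once, so [v] can be placed there instead and reduced
    afterwards. *)
Lemma act_res_steps t th k v v1 R q : steps v v1 -> act t th ((k, v1) :: R) q ->
  exists2 q', act t th ((k, v) :: R) q' & steps q' q.
Proof.
elim/pterm_ind_in: t th k v v1 R q => [n|t IH|t vs IHt IH|b t IH] th k v v1 R q Hs /=.
- case: (vr th n) => [m [] //|[-> <- ->]]; by exists v.
- move=> [q1 -> H]; have [q' Hq Hqs] := IH _ _ _ _ _ _ (steps_shift true Hs) H.
  by exists (PLam q'); [exists q' | exact: steps_lam].
- move=> [q1 [us [R0 [R1 [-> /perm_cons_cat_inv[[S p0 p]|[S p1 p]] Ht HB]]]]].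
    have [q' Hq Hqs] := IHt _ _ _ _ _ _ Hs (act_perm p0 Ht).
    exists (PApp q' us); last exact: steps_fun.
    by exists q', us, ((k, v) :: S), R1; split=> //=; rewrite perm_cons.
  suff [us' HB' [l1 [x [y [l2 [E1 E2 Hxy]]]]]] :
      exists2 us', acts th vs ((k, v) :: S) us' &
      exists l1 x y l2, [/\ us' = l1 ++ x :: l2, us = l1 ++ y :: l2 & steps x y].
    exists (PApp q1 us'); last by rewrite E1 E2; exact: steps_arg.
    exists q1, us', R0, ((k, v) :: S); split=> //=.
    by rewrite perm_sym -cat1s perm_catCA perm_cons perm_sym.
  move: (bag_rel_perm p1 HB) IH => {HB Ht p p1}.
  elim: vs us S => [|x vs IHvs] [|u us] S //=.
  move=> [A0 [A1 [/perm_cons_cat_inv[[A p0 p]|[A p1 p]] Hx HB]]] IH.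
    have [y Hy Hys] := IH _ (mem_head _ _) _ _ _ _ _ _ Hs (act_perm p0 Hx).
    exists (y :: us); last by exists [::], y, u, us.
    by exists ((k, v) :: A), A1; split=> //=; rewrite perm_cons.
  have [|us' HB' [l1 [y [z [l2 [E1 E2 Hyz]]]]]] := IHvs _ _ (bag_rel_perm p1 HB).
    by move=> y yin; apply: IH; rewrite inE yin orbT.
  exists (u :: us'); last by exists (u :: l1), y, z, l2; rewrite E1 E2.
  exists A0, ((k, v) :: A); split=> //.
  by rewrite perm_sym -cat1s perm_catCA perm_cons perm_sym.
- move=> [c [q1 [-> H]]].
  have [q' Hq Hqs] := nact_res_steps_of
    (fun R q => IH _ _ _ _ R q (steps_shift false Hs)) (steps_shift false Hs) H.
  by exists (PMu c q'); [exists c, q' | exact: steps_mu].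
Qed.

Lemma nact_res_steps t th b k v v1 R c q :
  steps v v1 -> nact b t th ((k, v1) :: R) c q ->
  exists2 q', nact b t th ((k, v) :: R) c q' & steps q' q.
Proof. by move=> Hs; apply: (nact_res_steps_of _ Hs) => R' q'; exact: act_res_steps. Qed.

(** * Permutation of bags *)

Lemma canon_appP t vs t' vs' :
  canon (PApp t vs) = canon (PApp t' vs') <->
  canon t = canon t' /\ perm_eq (map canon vs) (map canon vs').
Proof.
have sortP := perm_sortP pterm_le_total pterm_le_trans pterm_le_anti.
by split=> [/= [-> /sortP]|/= [-> /sortP->]].
Qed.

Lemma canon_pren_canon t : forall f g,
  canon (pren f g (canon t)) = canon (pren f g t).
Proof.
elim/pterm_ind_in: t => [n|t IH|t vs IHt IH|b t IH] f g //=.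
- by rewrite IH.
- apply/canon_appP; split=> //; rewrite -!map_comp.
  apply: (@perm_trans _ (map (canon \o pren f g) (map canon vs))).
    by apply: perm_map; exact/permEl/perm_sort.
  rewrite -map_comp (_ : map _ _ = map (canon \o pren f g) vs) //.
  by apply/eq_in_map => v vin /=; exact: IH.
- by rewrite IH.
Qed.

Lemma eq_canon_pren f g t t' :
  canon t = canon t' -> canon (pren f g t) = canon (pren f g t').
Proof. by move=> E; rewrite -canon_pren_canon E canon_pren_canon. Qed.

Lemma eq_canon_shift c t t' :
  canon t = canon t' -> canon (shift c t) = canon (shift c t').
Proof. by case: c; exact: eq_canon_pren. Qed.

Definition canon_res (p : res) : res := (p.1, canon p.2).

Lemma canon_res_lift c R R' : map canon_res R = map canon_res R' ->
  map canon_res (lift_res c R) = map canon_res (lift_res c R').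
Proof.
elim: R R' => [|[k v] R IH] [|[k' v'] R'] //= [-> E /IH->].
by rewrite /canon_res /= (eq_canon_shift c E).
Qed.

Lemma canon_keyed k B B' :
  map canon B = map canon B' -> map canon_res (keyed k B) = map canon_res (keyed k B').
Proof. by elim: B B' => [|v B IH] [|v' B'] //= [Ev /IH->]; rewrite /canon_res /= Ev. Qed.

Lemma canon_res_split R R' A B : map canon_res R = map canon_res R' ->
  perm_eq R (A ++ B) -> exists A' B',
  [/\ perm_eq R' (A' ++ B'), map canon_res A = map canon_res A' &
      map canon_res B = map canon_res B'].
Proof.
move=> E /(perm_map canon_res); rewrite E map_cat => /perm_map_cat_inv.
by move=> [A' [B' [p <- <-]]]; exists A', B'.
Qed.

Lemma canon_keyed_inv k B R : map canon_res (keyed k B) = map canon_res R ->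
  exists2 B', R = keyed k B' & map canon B = map canon B'.
Proof.
elim: B R => [|v B IH] [|[k' v'] R] //=; first by exists [::].
by move=> [<- Ev /IH[B' -> EB]]; exists (v' :: B') => //=; rewrite Ev EB.
Qed.

Lemma canon_bag_perm vs vs' : perm_eq (map canon vs) (map canon vs') ->
  exists2 ws, perm_eq vs' ws & map canon vs = map canon ws.
Proof. exact: perm_map_inv. Qed.

Lemma nact_canon_of t t' b th R R' c u :
  (forall R R' u, map canon_res R = map canon_res R' -> act t th R u ->
     exists2 u', canon u = canon u' & act t' th R' u') ->
  map canon_res R = map canon_res R' -> nact b t th R c u ->
  exists2 u', canon u = canon u' & nact b t' th R' c u'.
Proof.
move=> IH E [-> H]; rewrite /nact /named_rel; move: H; case: (na th b); last first.
  by move=> /(IH _ _ _ E)[u' ? ?]; exists u'.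
move=> [R1 [B [u1 [-> /(canon_res_split E)[A' [S [p EA]]]]]]].
move=> /canon_keyed_inv[B' ES EB] /(IH _ _ _ EA)[u' Eu Hu]; subst S.
exists (PApp u' B'); last by split=> //; exists A', B', u'.
by apply/canon_appP; rewrite EB.
Qed.

(** Weak compositions do not depend on the listing of a bag, so a relisting of the arguments is
    matched by a relisting of the results. *)
Lemma act_canon t : forall t' th R R' u, canon t = canon t' ->
  map canon_res R = map canon_res R' -> act t th R u ->
  exists2 u', canon u = canon u' & act t' th R' u'.
Proof.
elim/pterm_ind_in: t => [n|t IH|t vs IHt IH|b t IH] [n'|t'|t' vs'|b' t'] //=
  th R R' u Et ER.
- case: Et => <-; case: (vr th n) => [m [ER0 ->]|ER0]; rewrite ER0 in ER.
    by exists (PVar m) => //; split=> //; case: R' ER.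
  by case: R' ER => [|[k v] []] // [<- Ev]; exists v.
- case: Et => Et [u1 -> H].
  have [u' Eu Hu] := IH _ _ _ _ _ Et (canon_res_lift true ER) H.
  by exists (PLam u'); rewrite /= ?Eu //; exists u'.
- move: Et => /canon_appP[Et /canon_bag_perm[ws pws Ews]].
  move=> [u1 [us [R0 [R1 [-> p Ht HB]]]]].
  have [S0 [S1 [pS E0 E1]]] := canon_res_split ER p.
  have [u' Eu Hu] := IHt _ _ _ _ _ Et E0 Ht.
  suff [us' Eus HB'] : exists2 us', map canon us = map canon us' & acts th ws S1 us'.
    have [us2 pus2 HB2] := bag_rel_perm_in HB' pws.
    exists (PApp u' us2); last by exists u', us2, S0, S1.
    by apply/canon_appP; split=> //; rewrite Eus; exact: perm_map.
  elim: vs ws us R1 S1 {pws p pS} HB E1 Ews IH => [|v vs IHvs] [|w ws] [|x us] R1 S1 //=.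
    by move=> -> /esym; case: S1 => // _ _ _; exists [::].
  move=> [P0 [P1 [pP Hv HB]]] E1 [Ev Evs] IH.
  have [Q0 [Q1 [pQ EQ0 EQ1]]] := canon_res_split E1 pP.
  have [y Ey Hy] := IH _ (mem_head _ _) _ _ _ _ _ Ev EQ0 Hv.
  have [|us' Eus Hus] := IHvs _ _ _ _ HB EQ1 Evs.
    by move=> z zin; apply: IH; rewrite inE zin orbT.
  by exists (y :: us'); rewrite /= ?Ey ?Eus //; exists Q0, Q1.
- case: Et => <- Et [c [u1 [-> H]]].
  have [u' Eu Hu] := nact_canon_of
    (fun R R' u => IH _ _ R R' u Et) (canon_res_lift false ER) H.
  by exists (PMu c u'); rewrite /= ?Eu //; exists c, u'.
Qed.

Lemma nact_canon t t' b th R R' c u : canon t = canon t' ->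
  map canon_res R = map canon_res R' -> nact b t th R c u ->
  exists2 u', canon u = canon u' & nact b t' th R' c u'.
Proof. by move=> Et; apply: nact_canon_of => S S' w; exact: act_canon. Qed.

(** * Head reduction *)

Fixpoint has_head (t : pterm) : bool :=
  match t with
  | PVar _ => false
  | PLam t => has_head t
  | PApp t _ => match t with PLam _ | PMu _ _ => true | _ => has_head t end
  | PMu _ t => match t with PMu _ _ => true | _ => has_head t end
  end.

(* The head redex is the outermost redex on the spine made of the bodies of
   abstractions and of the functions of applications.  It is shared by all the
   elements of a Taylor expansion. *)
Fixpoint hstep (t u : pterm) : Prop :=
  match t with
  | PVar _ => False
  | PLam t => exists2 u', u = PLam u' & hstep t u'
  | PApp t vs =>
      match t with
      | PLam r => beta_to r vs u
      | PMu b r => exists c u', u = PMu c u' /\ mu_to b r vs c u'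
      | _ => exists2 u', u = PApp u' vs & hstep t u'
      end
  | PMu b t =>
      match t with
      | PMu e r => u = PMu (nsubst b e) (pren id (nsubst b) r)
      | _ => exists2 u', u = PMu b u' & hstep t u'
      end
  end.

Definition ctor (t : pterm) : nat :=
  match t with PVar _ => 0 | PLam _ => 1 | PApp _ _ => 2 | PMu _ _ => 3 end.

Lemma has_head_canon t : has_head (canon t) = has_head t.
Proof.
elim/pterm_ind_in: t => [n|t IH|t vs IH _|b t IH] //=; first by case: t IH.
by case: t IH.
Qed.

Lemma hstep_canon t t' u : canon t = canon t' -> hstep t u ->
  exists2 u', canon u = canon u' & hstep t' u'.
Proof.
elim/pterm_ind_in: t t' u => [n|t IH|t vs IH _|b t IH] [n'|t'|t' vs'|b' t'] u Et //.
- case: Et => Et [u1 -> /(IH _ _ Et)[u' Eu Hu]].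
  by exists (PLam u'); rewrite /= ?Eu //; exists u'.
- move: Et => /canon_appP[Et Evs].
  have ctx w : hstep t w -> exists2 u', canon (PApp w vs) = canon u' &
      exists2 w', u' = PApp w' vs' & hstep t' w'.
    move=> /(IH _ _ Et)[w' Ew Hw]; exists (PApp w' vs'); last by exists w'.
    exact/canon_appP.
  case: t t' Et ctx {IH} => [n|r|r ws|b r] [n'|r'|r' ws'|b' r'] // Et ctx /=.
  + by move=> [? _ []].
  + case: Et => Et; have [ws pws Ews] := canon_bag_perm Evs.
    move=> /(act_canon Et (canon_keyed (inl 0) Ews))[u' Eu Hu]; exists u' => //.
    by apply: act_perm Hu; apply: keyed_perm; rewrite perm_sym.
  + by move=> [w -> /ctx].
  + case: Et => <- Et [c [u1 [-> H]]]; have [ws pws Ews] := canon_bag_perm Evs.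
    have E : map canon_res (keyed (inr 0) (map (shift false) vs)) =
             map canon_res (keyed (inr 0) (map (shift false) ws)).
      apply: canon_keyed.
      elim: vs ws Ews {Evs pws H ctx} => [|v vs IHvs] [|w ws] //= [Ev /IHvs->].
      by rewrite [canon (pren _ _ v)](eq_canon_shift false Ev).
    have [u' Eu Hu] := nact_canon Et E H.
    exists (PMu c u'); first by rewrite /= Eu.
    exists c, u'; split=> //; apply: nact_perm Hu.
    by apply/keyed_perm/perm_map; rewrite perm_sym.
- move: Et => [<- Et].
  have ctx w : hstep t w -> exists2 u', canon (PMu b w) = canon u' &
      exists2 w', u' = PMu b w' & hstep t' w'.
    move=> /(IH _ _ Et)[w' Ew Hw]; exists (PMu b w'); last by exists w'.
    by rewrite /= Ew.
  case: t t' Et ctx {IH} => [n|r|r ws|e r] [n'|r'|r' ws'|e' r'] // Et ctx.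
  + by move=> [? _ []].
  + by move=> [w -> /ctx].
  + by move=> [w -> /ctx].
  + case: Et => <- Et ->; exists (PMu (nsubst b e) (pren id (nsubst b) r')) => //.
    by rewrite /= (eq_canon_pren _ _ Et).
Qed.

(** The clause on [ctor] carries the induction: a function part which is an application stays one
    unless its own head redex is fired, so the head redex of the whole stays inside it. A step in
    the body of the head redex is exchanged by [act_nact_step], a step in its bag by [act_res_steps]
    or [nact_res_steps]. *)
Lemma step_head_swap t t1 : step t t1 -> has_head t ->
  hstep t t1 \/
  [/\ has_head t1, ctor t1 = ctor t &
      forall t3, hstep t1 t3 -> exists2 t2, hstep t t2 & steps t2 t3].
Proof.
elim=> {t t1}.
- by move=> r B u H _; left.
- by move=> b r B c u H _; left; exists c, u.
- by move=> a e r _; left.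
- move=> t u _ IH /IH[H|[Hh Hc H]]; [left|right]; first by exists u.
  split=> // _ [u3 -> /H[t2 H2 Hs]].
  by exists (PLam t2); [exists t2 | exact: steps_lam].
- move=> t u vs Htu IH.
  have ctx : ctor t = 2 -> has_head t -> hstep (PApp t vs) (PApp u vs) \/
    [/\ has_head (PApp u vs), ctor (PApp u vs) = ctor (PApp t vs) &
      forall t3, hstep (PApp u vs) t3 -> exists2 t2, hstep (PApp t vs) t2 & steps t2 t3].
    case: t Htu IH => // t ws Htu IH _ /IH[H|[Hh Hc H]]; [left|]; first by exists u.
    case: u Htu Hh Hc H {IH} => // u us Htu Hh _ H; right.
    split=> // _ [u3 -> /H[t2 H2 Hs]].
    by exists (PApp t2 vs); [exists t2 | exact: steps_fun].
  case: t Htu IH ctx => // [r|r ws|b r] Htu _ ctx Hh; last 2 first.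
  + exact: ctx.
  + right; have [b1 [r1 Eu]] : exists b1 r1, u = PMu b1 r1.
      by inversion Htu; do 2!eexists.
    rewrite {u ctx}Eu in Htu *; split=> // _ [c [u1 [-> H]]].
    have [_ Hn] := act_nact_step Htu.
    have [c' [q' [Hq Hs]]] := Hn _ _ _ _ erefl erefl _ _ _ _ H.
    by exists (PMu c' q') => //; exists c', q'.
  right; inversion Htu as [| | |r0 r1 Hr| | |]; subst; split=> // t3 H.
  exact: act_steps (rt_step _ _ _ _ Hr) H.
- move=> t v w vs vs' Hvw _ Hh; right.
  (* Brings the reduced argument to the front, where the lemmas on resources expect it. *)
  have perm_mid (T : eqType) (f : pterm -> T) x :
      perm_eq (map f (vs ++ x :: vs')) (f x :: map f (vs ++ vs')).
    by rewrite !map_cat /= -cat1s perm_catCA.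
  case: t Hh => // [r|r ws|b r] Hh; split=> //= t3.
  + move=> /(act_perm (perm_mid _ (pair (inl 0)) w)) H.
    have [q Hq Hs] := act_res_steps (rt_step _ _ _ _ Hvw) H.
    exists q => //; apply: act_perm Hq; rewrite perm_sym; exact: perm_mid.
  + move=> [u -> Hu]; exists (PApp u (vs ++ v :: vs')); first by exists u.
    exact/steps_arg/rt_step.
  + move=> [c [u [-> H]]]; rewrite /mu_to /keyed -map_comp in H.
    have {}H := nact_perm (perm_mid _ (pair (inr 0) \o shift false) w) H.
    have [q Hq Hs] := nact_res_steps (steps_shift false (rt_step _ _ _ _ Hvw)) H.
    exists (PMu c q); last exact: steps_mu.
    exists c, q; split=> //; apply: nact_perm Hq.
    rewrite perm_sym /keyed -map_comp; exact: perm_mid.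
- move=> b t u Htu IH.
  have ctx : ctor t != 3 -> has_head t -> hstep (PMu b t) (PMu b u) \/
    [/\ has_head (PMu b u), ctor (PMu b u) = ctor (PMu b t) &
      forall t3, hstep (PMu b u) t3 -> exists2 t2, hstep (PMu b t) t2 & steps t2 t3].
    move=> Ht /IH[H|[Hh Hc H]]; [left|right].
      by case: t Ht H {Htu IH} => // [r|r ws] _ H; exists u.
    split=> //; first by rewrite -Hc in Ht; case: u Ht Hh {Htu IH Hc H}.
    move=> t3 H3; suff [u3 E3 /H[t2 H2 Hs]] : exists2 u3, t3 = PMu b u3 & hstep u u3.
      rewrite E3; exists (PMu b t2); last exact: steps_mu.
      by case: t Ht H2 {Htu IH Hc H} => // [r|r ws] _ H; exists t2.
    by rewrite -Hc in Ht; case: u Ht H3 {Htu IH Hc H Hh}.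
  case: t Htu IH ctx => // [r|r ws|e r] Htu _ ctx Hh; try exact: ctx.
  right; have [e1 [r1 Eu]] : exists e1 r1, u = PMu e1 r1.
    by inversion Htu; do 2!eexists.
  rewrite {u ctx}Eu in Htu *; split=> // _ ->.
  eexists; first by [].
  have [_ Hn] := act_nact_step Htu.
  have H : nact e1 r1 (ren_env id (nsubst b)) [::] (nsubst b e1) (pren id (nsubst b) r1).
    exact/nact_ren_env.
  have [c' [q' [/nact_ren_env[-> ->] Hs]]] := Hn _ _ _ _ erefl erefl _ _ _ _ H.
  exact: Hs.
Qed.

(** * Reduction of resource terms *)

Lemma rep_canon (t : rterm) : canon (rep t) = rep t.
Proof. exact/eqP/(valP t). Qed.

Lemma cls_rep t : cls (rep t) = t.
Proof. by apply: val_inj; exact: rep_canon. Qed.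

Lemma eq_clsP t u : cls t = cls u <-> canon t = canon u.
Proof. by split=> [[]|E] //; apply: val_inj. Qed.

Lemma cls_lam t : cls (PLam t) = rlam (cls t).
Proof. by apply: val_inj; rewrite /= canon_idem. Qed.

Lemma cls_mu b t : cls (PMu b t) = rmu b (cls t).
Proof. by apply: val_inj; rewrite /= canon_idem. Qed.

Lemma canon_rapp t (B : {mset rterm}) vs : perm_eq B (map cls vs) ->
  rapp t B = cls (PApp (rep t) vs).
Proof.
move=> p; apply/eq_clsP/canon_appP; split=> //.
rewrite -map_comp (_ : map canon vs = map (canon \o rep) (map cls vs)).
  exact: perm_map.
by rewrite -map_comp; apply: eq_map => v /=; rewrite canon_idem.
Qed.

Lemma cls_app t vs : cls (PApp t vs) = rapp (cls t) (seq_mset (map cls vs)).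
Proof.
rewrite (canon_rapp _ (perm_eq_seq_mset _)); apply/eq_clsP/canon_appP.
by rewrite /= canon_idem.
Qed.

Definition normal (t : pterm) := forall T, ~ red (cls t) T.

Lemma normal_canon t u : canon t = canon u -> normal t -> normal u.
Proof. by move/eq_clsP=> E; rewrite /normal E. Qed.

Lemma normal_lam t : normal (PLam t) -> normal t.
Proof. by rewrite /normal cls_lam => H T /red_ctx_lam/H. Qed.

Lemma normal_mu b t : normal (PMu b t) -> normal t.
Proof. by rewrite /normal cls_mu => H T /(red_ctx_mu b)/H. Qed.

Lemma normal_fun t vs : normal (PApp t vs) -> normal t.
Proof.
by rewrite /normal cls_app => H T /(red_ctx_fun (seq_mset (map cls vs)))/H.
Qed.

Lemma normal_arg t vs v : normal (PApp t vs) -> v \in vs -> normal v.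
Proof.
rewrite /normal cls_app => H vin T Hv.
have p : perm_eq (map cls vs) (cls v :: map cls (rem v vs)).
  exact: (perm_map cls (perm_to_rem vin)).
move/eq_seq_msetP: p H => ->; rewrite mset_cons => H.
exact: H (red_ctx_arg _ _ Hv).
Qed.

(** [red] applies to every redex, even to one whose reduct is the empty sum, so the summands need
    not be examined. *)
Lemma has_head_red t : has_head t -> ~ normal t.
Proof.
elim/pterm_ind_in: t => [n|t IH|t vs IH _|b t IH] //=.
- by move=> /IH H /normal_lam.
- case: t IH => [n|r|r ws|b r] //= IH Hh.
  + by rewrite /normal cls_app cls_lam => H; exact: H (red_lam _ _).
  + by move=> /normal_fun; exact: IH.
  + by rewrite /normal cls_app cls_mu => H; exact: H (red_mu _ _ _).
- case: t IH => [n|r|r ws|e r] //= IH Hh.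
  + by move=> /normal_mu; exact: IH.
  + by move=> /normal_mu; exact: IH.
  + by rewrite /normal !cls_mu => H; exact: H (red_rho _ _ _).
Qed.

Definition pstep t u := step t u \/ canon t = canon u.
Definition psteps := clos_refl_trans pterm pstep.

Lemma steps_psteps t u : steps t u -> psteps t u.
Proof. by apply: (clos_rt_map (f := id)) => x y; left. Qed.

Lemma psteps_canon t u : canon t = canon u -> psteps t u.
Proof. by move=> E; apply: rt_step; right. Qed.

(** By induction on the given thread: the head step found in its tail is moved across its first
    step. The swap may produce a longer thread, which is harmless since only one head step is
    extracted. *)
Lemma head_standardization t u : psteps t u -> normal u -> has_head t ->
  exists2 t2, hstep t t2 & psteps t2 u.
Proof.
move=> Htu; have H := Operators_Properties.clos_rt_rt1n _ _ _ _ Htu.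
elim: H {Htu} => {t u} [t Ht /has_head_red//|t t1 u Htt1 Ht1 IH Hu Hh].
have {}Ht1 : psteps t1 u by exact: Operators_Properties.clos_rt1n_rt.
case: Htt1 => [Hs|E].
  have [H|[Hh1 _ Hsw]] := step_head_swap Hs Hh; first by exists t1.
  have [t3 /Hsw[t2 H2 Hs2] Ht3] := IH Hu Hh1.
  by exists t2 => //; apply: rt_trans Ht3; exact: steps_psteps.
have [|t3 H3 Ht3] := IH Hu; first by rewrite -has_head_canon -E has_head_canon.
have [t2 E2 H2] := hstep_canon (esym E) H3.
by exists t2 => //; apply: rt_trans Ht3; exact: psteps_canon.
Qed.

(** * The computed sums as linear actions *)

Lemma push_at_perm (T : eqType) i (v : T) Bs : i < size Bs ->
  size (push_at i v Bs) = size Bs /\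
  perm_eq (flatten (push_at i v Bs)) (v :: flatten Bs).
Proof.
rewrite /push_at; elim: Bs i => [|B Bs IH] [|i] //=.
rewrite ltnS => /IH[-> p]; split=> //.
by rewrite perm_sym -cat1s perm_catCA perm_cat2l perm_sym.
Qed.

Lemma wcomps_perm (T : eqType) k (B : seq T) Bs : Bs \in wcomps k B ->
  size Bs = k /\ perm_eq B (flatten Bs).
Proof.
elim: B Bs => [|v B IH] Bs /=.
  rewrite inE => /eqP->; rewrite size_nseq; split=> //.
  by elim: k.
move=> /allpairsP[[Bs' i] /= [/IH[<- p] + ->]].
rewrite mem_iota add0n => /andP[_ /push_at_perm H].
by have [-> q] := H v; split=> //; rewrite (permPr q) perm_cons.
Qed.

Lemma distribute_act t vs th k f (G : pterm -> seq pterm -> seq pterm) B u :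
  (forall B u, u \in f B -> act t th (keyed k B) u) ->
  (forall v, v \in vs -> forall B u, u \in G v B -> act v th (keyed k B) u) ->
  u \in distribute f [seq G v | v <- vs] B -> act (PApp t vs) th (keyed k B) u.
Proof.
move=> Hf HG /flattenP[_ /mapP[Bs HBs ->] /allpairsP[[u0 us] /= [Hu0 Hus ->]]].
have [sz p] := wcomps_perm HBs; rewrite size_map in sz.
case: Bs sz p {HBs} Hu0 Hus => //= B0 Bs [sz] p /Hf Hu0 Hus.
exists u0, us, (keyed k B0), (keyed k (flatten Bs)); split=> //.
  by rewrite -keyed_cat; exact: keyed_perm.
elim: vs Bs us sz Hus HG {p} => [|v vs IH] [|B1 Bs] us //=.
  by rewrite inE => _ /eqP->.
move=> [sz] /allpairsP[[w ws] /= [Hw Hws ->]] HG.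
exists (keyed k B1), (keyed k (flatten Bs)); split; first by rewrite -keyed_cat.
  by apply: HG Hw; exact: mem_head.
by apply: IH => // x xin; apply: HG; rewrite inE xin orbT.
Qed.

Lemma lift_keyed_v k B : lift_res true (keyed (inl k) B) = keyed (inl k.+1) (liftV B).
Proof. by rewrite /lift_res /keyed /liftV -!map_comp. Qed.

Lemma lift_keyed_n k B : lift_res false (keyed (inr k) B) = keyed (inr k.+1) (liftN B).
Proof. by rewrite /lift_res /keyed /liftN -!map_comp. Qed.

Lemma lift_keyed_vn k B : lift_res false (keyed (inl k) B) = keyed (inl k) (liftN B).
Proof. by rewrite /lift_res /keyed /liftN -!map_comp. Qed.

Lemma lift_keyed_nv k B : lift_res true (keyed (inr k) B) = keyed (inr k) (liftV B).
Proof. by rewrite /lift_res /keyed /liftV -!map_comp. Qed.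

Lemma plsubst_act t k B u :
  u \in plsubst t k B -> act t (subst_env k) (keyed (inl k) B) u.
Proof.
elim/pterm_ind_in: t k B u => [n|t IH|t vs IHt IH|b t IH] k B u /=.
- case: eqP => [->|_]; first by case: B => [|v []] //; rewrite inE => /eqP->.
  by case: B => // ; rewrite inE => /eqP->.
- move=> /mapP[u' Hu ->]; exists u' => //; rewrite lift_keyed_v.
  apply: act_ext (IH _ _ _ Hu); split=> // -[|n] //=.
  rewrite eqSS; case: eqP => //= /eqP ne; rewrite ltnS.
  by case: ltnP => //; case: n ne.
- apply: distribute_act; first exact: IHt.
  by move=> v vin B' u'; exact: IH.
- move=> /mapP[u' Hu ->]; exists b, u'; split=> //; split; first by case: b.
  rewrite (_ : na _ b = false); last by case: b.
  rewrite lift_keyed_vn; apply: act_ext (IH _ _ _ Hu).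
  by split=> // -[|n].
Qed.

Lemma named_app_nact t f e a B c u :
  (forall B u, u \in f B -> act t (name_env a) (keyed (inr a) B) u) ->
  (c, u) \in named_app f e a B -> nact e t (name_env a) (keyed (inr a) B) c u.
Proof.
rewrite /nact /named_rel /named_app /= => Hf; case: eqP => [->|_].
  move=> /flattenP[_ /mapP[Bs HBs ->] /mapP[u' Hu [-> ->]]]; split=> //.
  have [sz p] := wcomps_perm HBs.
  case: Bs sz p {HBs} Hu => [|B0 [|B1 []]] //= _; rewrite cats0 => p /Hf Hu.
  exists (keyed (inr a) B0), B1, u'; split=> //.
  by rewrite -keyed_cat; exact: keyed_perm.
by move=> /mapP[u' /Hf Hu [-> ->]].
Qed.

Lemma up_name_env c a :
  eq_env (name_env (if c then a else a.+1)) (up_env c (name_env a)).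
Proof. by case: c; split=> // -[|n]. Qed.

Lemma plnapp_act t a B u :
  u \in plnapp t a B -> act t (name_env a) (keyed (inr a) B) u.
Proof.
elim/pterm_ind_in: t a B u => [n|t IH|t vs IHt IH|b t IH] a B u /=.
- by case: B => //; rewrite inE => /eqP->.
- move=> /mapP[u' Hu ->]; exists u' => //; rewrite lift_keyed_nv.
  exact: act_ext (up_name_env true a) (IH _ _ _ Hu).
- apply: distribute_act; first exact: IHt.
  by move=> v vin B' u'; exact: IH.
- move=> /mapP[[c u'] /= Hu ->]; exists c, u'; split=> //; rewrite lift_keyed_n.
  apply: nact_ext (up_name_env false a) _.
  by apply: named_app_nact Hu => B' w; exact: IH.
Qed.

(** * From reductions of sums to threads *)

Lemma psteps_lam t u : psteps t u -> psteps (PLam t) (PLam u).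
Proof.
apply: clos_rt_map => x y [H|E]; [left; exact: step_in_lam | right].
by rewrite /= E.
Qed.

Lemma psteps_mu b t u : psteps t u -> psteps (PMu b t) (PMu b u).
Proof.
apply: clos_rt_map => x y [H|E]; [left; exact: step_in_mu | right].
by rewrite /= E.
Qed.

Lemma psteps_fun t u vs : psteps t u -> psteps (PApp t vs) (PApp u vs).
Proof.
apply: (clos_rt_map (f := fun t => PApp t vs)) => x y [H|E].
  by left; exact: step_in_fun.
by right; apply/canon_appP.
Qed.

Lemma psteps_head_arg t v w vs :
  psteps v w -> psteps (PApp t (v :: vs)) (PApp t (w :: vs)).
Proof.
apply: (clos_rt_map (f := fun v => PApp t (v :: vs))) => x y [H|E].
  by left; exact: (step_in_arg t [::] vs H).
by right; apply/canon_appP; rewrite /= E.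
Qed.

Lemma psteps_cls x y t u : rep t = canon x -> psteps x y -> rep u = canon y ->
  psteps (rep t) (rep u).
Proof.
move=> -> H ->; apply: (rt_trans _ _ _ x).
  by apply: psteps_canon; exact: canon_idem.
by apply: rt_trans H _; apply: psteps_canon; rewrite canon_idem.
Qed.

Lemma map_cls_rep (B : seq rterm) : map cls (map rep B) = B.
Proof. by rewrite -map_comp -[RHS]map_id; apply: eq_map => t /=; exact: cls_rep. Qed.

Lemma rep_rapp t (B : {mset rterm}) vs : perm_eq B (map cls vs) ->
  rep (rapp t B) = canon (PApp (rep t) vs).
Proof. by move=> p; rewrite (canon_rapp t p). Qed.

Lemma red_psteps t T u : red t T -> u \in T -> psteps (rep t) (rep u).
Proof.
move=> H; elim: H u => {t T}.
- move=> t B u /imfsetP[u0 Hu ->]; rewrite /= in Hu.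
  apply: (@psteps_cls (PApp (PLam (rep t)) (map rep B)) u0) => //.
    by apply/canon_appP; split=> //; rewrite /= canon_idem.
  by apply: rt_step; left; apply: step_beta; exact: plsubst_act.
- move=> b t B u /imfsetP[[c u0] Hu ->]; rewrite /= in Hu.
  apply: (@psteps_cls (PApp (PMu b (rep t)) (map rep B)) (PMu c u0)) => //.
    by apply/canon_appP; split=> //; rewrite /= canon_idem.
  apply: rt_step; left; apply: step_mu.
  by apply: named_app_nact Hu => B' w; exact: plnapp_act.
- move=> a e t u; rewrite inE => /eqP->.
  apply: (@psteps_cls (PMu a (PMu e (rep t)))
    (PMu (nsubst a e) (pren id (nsubst a) (rep t)))) => //.
  + by rewrite /= canon_idem.
  + by apply: rt_step; left; exact: step_rho.
  + by rewrite /= canon_idem.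
- move=> t S _ IH u /imfsetP[u0 /IH Hu ->].
  by apply: (@psteps_cls (PLam (rep t)) (PLam (rep u0))) => //; exact: psteps_lam.
- move=> t S B _ IH u /imfsetP[u0 /IH Hu ->].
  apply: (@psteps_cls (PApp (rep t) (map rep B)) (PApp (rep u0) (map rep B))) => //.
  exact: psteps_fun.
- move=> t v S B _ IH u /imfsetP[u0 /IH Hu ->].
  have p (w : rterm) : perm_eq (w +` B)%mset (map cls (rep w :: map rep B)).
    rewrite /= map_cls_rep cls_rep -{1}[B]seq_mset_id -mset_cons.
    exact: perm_eq_seq_mset.
  apply: (@psteps_cls (PApp (rep t) (rep v :: map rep B))
                      (PApp (rep t) (rep u0 :: map rep B))).
  + exact: rep_rapp.
  + exact: psteps_head_arg.
  + exact: rep_rapp.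
- move=> b t S _ IH u /imfsetP[u0 /IH Hu ->].
  by apply: (@psteps_cls (PMu b (rep t)) (PMu b (rep u0))) => //; exact: psteps_mu.
Qed.

Lemma red_sum_psteps (S1 S2 : {fset rterm}) u :
  clos_refl_trans _ red_sum S1 S2 -> u \in S2 ->
  exists2 t, t \in S1 & psteps (rep t) (rep u).
Proof.
move=> H; elim: H u => {S1 S2} [_ _ [t T S Ht _] u|S u Hu|S1 S2 S3 _ IH1 _ IH2 u].
- rewrite in_fsetU => /orP[uT|uS].
    by exists t; [exact: fset1U1 | exact: red_psteps uT].
  by exists u; [exact: fset1Ur | exact: rt_refl].
- by exists u => //; exact: rt_refl.
- move=> /IH2[v /IH1[t tS H1] H2]; exists t => //; exact: rt_trans H1 H2.
Qed.

Lemma is_nf_psteps t S u : is_nf t S -> u \in S ->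
  psteps (rep t) (rep u) /\ normal (rep u).
Proof.
move=> [H Hn] uS; split.
  by have [v] := red_sum_psteps H uS; rewrite inE => /eqP->.
(* A reduct of the summand [u] would reduce the whole sum, seen as [u] added to [S] without [u]. *)
move=> T; rewrite cls_rep => Hu; apply: (Hn (T `|` (S `\ u))%fset).
by rewrite -{1}(fsetD1K uS); apply: red_sum_step => //; rewrite !inE eqxx.
Qed.

(** * Termination of head reduction *)

Fixpoint weight (wl wm : nat) (t : pterm) : nat :=
  match t with
  | PVar _ => 0
  | PLam t => wl + weight wl wm t
  | PApp t vs => weight wl wm t + sumn (map (weight wl wm) vs)
  | PMu _ t => wm + weight wl wm t
  end.

Notation nlam := (weight 1 0).
Notation nmu := (weight 0 1).

(* [copies t] is the number of applications to which a bag applied to [t] gives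
   rise under reduction of mu-redexes only, and [copies_at t d] is the sum of
   the [copies] of the subterms of [t] which are named by [d]. *)
Fixpoint copies (t : pterm) : nat :=
  match t with
  | PVar _ | PLam _ => 1
  | PApp t _ => copies t
  | PMu b t => 1 + (b == 0) * copies t + copies_at t 0
  end
with copies_at (t : pterm) (d : nat) : nat :=
  match t with
  | PVar _ => 0
  | PLam t => copies_at t d
  | PApp t vs => copies_at t d + sumn (map (fun v => copies_at v d) vs)
  | PMu b t => (b == d.+1) * copies t + copies_at t d.+1
  end.

Fixpoint pending (t : pterm) : nat :=
  match t with
  | PVar _ => 0
  | PLam t => pending t
  | PApp t vs => copies t + pending t + sumn (map pending vs)
  | PMu _ t => pending t
  end.

Definition res_sum (f : pterm -> nat) (R : seq res) := sumn [seq f p.2 | p <- R].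

Lemma res_sum_perm f R R' : perm_eq R R' -> res_sum f R = res_sum f R'.
Proof. by move=> p; apply: perm_sumn; exact: perm_map. Qed.

Lemma res_sum_cat f R R' : res_sum f (R ++ R') = res_sum f R + res_sum f R'.
Proof. by rewrite /res_sum map_cat sumn_cat. Qed.

Lemma res_sum_keyed f k B : res_sum f (keyed k B) = sumn (map f B).
Proof. by rewrite /res_sum /keyed -map_comp. Qed.

Lemma res_sum_lift f f' c R : (forall v, f (shift c v) = f' v) ->
  res_sum f (lift_res c R) = res_sum f' R.
Proof.
move=> H; rewrite /res_sum /lift_res -map_comp; congr sumn.
by apply: eq_map => p /=.
Qed.

Lemma weight_pren wl wm t : forall f g, weight wl wm (pren f g t) = weight wl wm t.
Proof.
elim/pterm_ind_in: t => [n|t IH|t vs IHt IH|b t IH] f g //=.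
- by rewrite IH.
- rewrite IHt -map_comp; congr (_ + sumn _).
  by apply/eq_in_map => v vin /=; exact: IH.
- by rewrite IH.
Qed.

Lemma weight_shift wl wm c t : weight wl wm (shift c t) = weight wl wm t.
Proof. by case: c; exact: weight_pren. Qed.

Lemma nact_weight_of wl wm b t th R c u :
  (forall R u, act t th R u ->
    weight wl wm u = weight wl wm t + res_sum (weight wl wm) R) ->
  nact b t th R c u -> weight wl wm u = weight wl wm t + res_sum (weight wl wm) R.
Proof.
move=> IH [_]; case: (na th b); last exact: IH.
move=> [R1 [B [u' [-> p /IH /= ->]]]].
by rewrite (res_sum_perm _ p) res_sum_cat res_sum_keyed addnA.
Qed.

(** Each resource is used once, while the variables that disappear and the applications that are
    created weigh nothing. *)
Lemma act_weight wl wm t th R u : act t th R u ->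
  weight wl wm u = weight wl wm t + res_sum (weight wl wm) R.
Proof.
elim/pterm_ind_in: t th R u => [n|t IH|t vs IHt IH|b t IH] th R u /=.
- by case: (vr th n) => [m [-> ->]|->] //; rewrite /res_sum /= addn0.
- move=> [u' -> /IH /= ->]; rewrite (res_sum_lift _ (weight_shift wl wm true)).
  by rewrite addnA.
- move=> [u' [us [R0 [R1 [-> p /IHt /= -> HB]]]]].
  rewrite (res_sum_perm _ p) res_sum_cat.
  suff -> : sumn (map (weight wl wm) us) =
      sumn (map (weight wl wm) vs) + res_sum (weight wl wm) R1.
    by lia.
  elim: vs us R1 {p} HB IH => [|v vs IHvs] [|w us] R1 //=; first by move=> ->.
  move=> [S0 [S1 [p Hv Hvs]]] IH.
  rewrite (IH _ (mem_head _ _) _ _ _ Hv) (IHvs _ _ Hvs); last first.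
    by move=> x xin; apply: IH; rewrite inE xin orbT.
  by rewrite (res_sum_perm _ p) res_sum_cat; lia.
- move=> [c [u' [-> H]]] /=.
  rewrite (nact_weight_of (IH _) H) (res_sum_lift _ (weight_shift wl wm false)).
  by rewrite addnA.
Qed.

Lemma nact_weight wl wm b t th R c u : nact b t th R c u ->
  weight wl wm u = weight wl wm t + res_sum (weight wl wm) R.
Proof. by apply: nact_weight_of => S w; exact: act_weight. Qed.

Lemma copies_pren t : forall f g, injective g ->
  copies (pren f g t) = copies t /\
  (forall d, copies_at (pren f g t) (g d) = copies_at t d).
Proof.
elim/pterm_ind_in: t => [n|t IH|t vs IHt IH|b t IH] f g Ig //=.
- by split=> // d; case: (IH (up_ren f) g Ig).
- have [E Ea] := IHt f g Ig; split=> // d; rewrite Ea -map_comp.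
  by congr (_ + sumn _); apply/eq_in_map => v vin /=; case: (IH v vin f g Ig).
- have Iu := up_ren_inj Ig; have [E Ea] := IH f _ Iu; rewrite E; split=> [|d].
    by rewrite (Ea 0); case: b.
  by rewrite (Ea d.+1); congr (_ * _ + _); case: b => //= b; rewrite !eqSS (inj_eq Ig).
Qed.

Lemma copies_at_fresh t : forall f g d, (forall n, g n != d) ->
  copies_at (pren f g t) d = 0.
Proof.
elim/pterm_ind_in: t => [n|t IH|t vs IHt IH|b t IH] f g d Hg //=.
- exact: IH.
- rewrite IHt // -map_comp; elim: vs IH => //= v vs IHvs IH.
  rewrite IH ?mem_head // add0n; apply: IHvs => x xin.
  by apply: IH; rewrite inE xin orbT.
- rewrite IH; last by case.
  by case: b => //= b; rewrite eqSS (negPf (Hg b)).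
Qed.

Lemma pending_pren t : forall f g, injective g -> pending (pren f g t) = pending t.
Proof.
elim/pterm_ind_in: t => [n|t IH|t vs IHt IH|b t IH] f g Ig //=.
- exact: IH.
- rewrite IHt // (copies_pren _ _ Ig).1 -map_comp; congr (_ + sumn _).
  by apply/eq_in_map => v vin /=; exact: IH.
- exact/IH/up_ren_inj.
Qed.

Lemma copies_at_shift c v d :
  copies_at (shift c v) (if c then d else d.+1) = copies_at v d.
Proof.
case: c; first exact: (copies_pren v succn (@inj_id nat)).2.
exact: (copies_pren v id succn_inj).2.
Qed.

Lemma pending_shift c v : pending (shift c v) = pending v.
Proof. by case: c; apply: pending_pren => //; exact: succn_inj. Qed.

(** In the last equation, every subterm named by [a] becomes the function of a new application,
    which is charged the [copies] of that subterm. *)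
Definition name_act_spec t a R u :=
  [/\ copies u = copies t, copies_at u a = copies_at t a,
      forall d, d != a ->
        copies_at u d = copies_at t d + res_sum (fun v => copies_at v d) R &
      pending u = pending t + res_sum pending R + copies_at t a].

Lemma nact_name_copies_of b t a R c u :
  (forall R u, (forall p, p \in R -> copies_at p.2 a = 0) ->
     act t (name_env a) R u -> name_act_spec t a R u) ->
  (forall p, p \in R -> copies_at p.2 a = 0) ->
  nact b t (name_env a) R c u ->
  [/\ c = b, copies u = copies t, copies_at u a = copies_at t a,
      forall d, d != a ->
        copies_at u d = copies_at t d + res_sum (fun v => copies_at v d) R &
      pending u = pending t + res_sum pending R + copies_at t a + (b == a) * copies t].
Proof.
move=> IH HR [-> /=]; case: eqP => [->|_]; last first.
  by move=> /(IH _ _ HR)[? ? ? ->]; split=> //; rewrite addn0.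
move=> [R1 [B [u' [-> p Hu]]]].
have [|E1 E2 E3 E4] := IH _ _ _ Hu.
  by move=> q qin; apply: HR; rewrite (perm_mem p) mem_cat qin.
rewrite /= E1 E2 E4; split=> //.
- rewrite (_ : sumn _ = 0) ?addn0 //.
  have HB v : v \in B -> copies_at v a = 0.
    move=> vin; apply: (HR (inr a, v)); rewrite (perm_mem p) mem_cat.
    by rewrite (map_f (pair (inr a)) vin) orbT.
  elim: B HB {p} => //= v B IHB HB; rewrite HB ?mem_head // IHB // => x xin.
  by apply: HB; rewrite inE xin orbT.
- by move=> d Hd; rewrite E3 // (res_sum_perm _ p) res_sum_cat res_sum_keyed addnA.
- by rewrite (res_sum_perm _ p) res_sum_cat res_sum_keyed; lia.
Qed.

Lemma act_name_copies t a R u :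
  (forall p, p \in R -> copies_at p.2 a = 0) ->
  act t (name_env a) R u -> name_act_spec t a R u.
Proof.
have eq_env_sym th th' : eq_env th th' -> eq_env th' th.
  by move=> [? ? ?]; split; exact: fsym.
have HR_lift c b S : (forall p, p \in S -> copies_at p.2 b = 0) ->
    forall p, p \in lift_res c S -> copies_at p.2 (if c then b else b.+1) = 0.
  by move=> HS _ /mapP[p pin ->] /=; rewrite copies_at_shift; exact: HS.
elim/pterm_ind_in: t a R u => [n|t IH|t vs IHt IH|b t IH] a R u HR /=.
- by move=> [-> ->]; split.
- move=> [u' -> /(act_ext (eq_env_sym _ _ (up_name_env true a)))].
  move=> /(IH _ _ _ (HR_lift true _ _ HR))[E1 E2 E3 E4]; split=> //=.
    move=> d Hd; rewrite E3 //; congr (_ + _).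
    by apply: res_sum_lift => v; exact: (copies_at_shift true).
  by rewrite E4; congr (_ + _ + _); apply: res_sum_lift => v; exact: pending_shift.
- move=> [u' [us [R0 [R1 [-> p Ht HB]]]]].
  have [|E1 E2 E3 E4] := IHt _ _ _ _ Ht.
    by move=> q qin; apply: HR; rewrite (perm_mem p) mem_cat qin.
  have HR1 q : q \in R1 -> copies_at q.2 a = 0.
    by move=> qin; apply: HR; rewrite (perm_mem p) mem_cat qin orbT.
  suff [F2 F3 F4] : [/\
      sumn (map (copies_at^~ a) us) = sumn (map (copies_at^~ a) vs),
      forall d, d != a -> sumn (map (copies_at^~ d) us) =
        sumn (map (copies_at^~ d) vs) + res_sum (copies_at^~ d) R1 &
      sumn (map pending us) = sumn (map pending vs) + res_sum pending R1 +
        sumn (map (copies_at^~ a) vs)].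
    split=> //=; rewrite ?E1 ?E2 ?E4 ?F2 ?F4 //.
      by move=> d Hd; rewrite E3 // F3 // (res_sum_perm _ p) res_sum_cat; lia.
    by rewrite (res_sum_perm _ p) res_sum_cat; lia.
  elim: vs us R1 {p E1 E2 E3 E4 HR} HB HR1 IH => [|v vs IHvs] [|w us] R1 //=.
    by move=> -> _ _; split.
  move=> [S0 [S1 [p Hv Hvs]]] HR1 IH.
  have [|E1 E2 E3 E4] := IH _ (mem_head _ _) _ _ _ _ Hv.
    by move=> q qin; apply: HR1; rewrite (perm_mem p) mem_cat qin.
  have [||F2 F3 F4] := IHvs _ _ Hvs.
  + by move=> q qin; apply: HR1; rewrite (perm_mem p) mem_cat qin orbT.
  + by move=> x xin; apply: IH; rewrite inE xin orbT.
  split; rewrite ?E2 ?F2 ?E4 ?F4 //.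
    by move=> d Hd; rewrite E3 // F3 // (res_sum_perm _ p) res_sum_cat; lia.
  by rewrite (res_sum_perm _ p) res_sum_cat; lia.
- move=> [c [u' [-> /(nact_ext (eq_env_sym _ _ (up_name_env false a)))]]].
  move=> /(nact_name_copies_of (IH _) (HR_lift false _ _ HR)).
  move=> [-> E1 E2 E3 E4]; split=> /=; rewrite ?E1 ?E2 //.
  (* Lifted resources do not contain the bound name 0, so they add nothing to [copies_at] there. *)
  + rewrite E3 // (res_sum_lift (f' := fun=> 0)); last first.
      by move=> v; apply: copies_at_fresh.
    by rewrite /res_sum (_ : sumn _ = 0) ?addn0 //; elim: (R).
  + move=> d Hd; rewrite E3 // -addnA; congr (_ + (_ + _)).
    by apply: res_sum_lift => v; exact: (copies_at_shift false).
  + by rewrite E4 (res_sum_lift _ (pending_shift false)); lia.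
Qed.

(** The 1 in the [copies] of a mu stands for the application of the redex, which disappears; the
    other terms pay exactly for the applications created in the body. The two equalities keep the
    charges of the surrounding applications unchanged. *)
Lemma mu_to_copies b r B c u : mu_to b r B c u ->
  [/\ copies (PMu c u) = copies (PApp (PMu b r) B),
      forall d, copies_at (PMu c u) d = copies_at (PApp (PMu b r) B) d &
      pending (PMu c u) < pending (PApp (PMu b r) B)].
Proof.
have fresh v : copies_at (shift false v) 0 = 0 by apply: copies_at_fresh.
have HR p : p \in keyed (inr 0) (map (shift false) B) -> copies_at p.2 0 = 0.
  by move=> /mapP[_ /mapP[v _ ->] ->] /=; exact: fresh.
move=> /(nact_name_copies_of (@act_name_copies r 0) HR)[-> E1 E2 E3 E4].
split=> /=; rewrite ?E1 ?E2 //.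
  move=> d; rewrite E3 // res_sum_keyed -map_comp addnA.
  by congr (_ + sumn _); apply: eq_map => v; exact: (copies_at_shift false).
rewrite E4 res_sum_keyed -map_comp.
rewrite (eq_map (_ : pending \o shift false =1 pending)); last first.
  exact: (pending_shift false).
lia.
Qed.

(* The three cases are those of a beta-, a rho- and a mu-redex. *)
Lemma hstep_decr t u : hstep t u ->
  [\/ nlam u < nlam t, nlam u = nlam t /\ nmu u < nmu t |
      [/\ nlam u = nlam t, nmu u = nmu t, copies u = copies t,
          forall d, copies_at u d = copies_at t d & pending u < pending t]].
Proof.
have sum_shift wl wm B : res_sum (weight wl wm) (keyed (inr 0) (map (shift false) B)) =
    sumn (map (weight wl wm) B).
  rewrite res_sum_keyed -map_comp; congr sumn.
  by apply: eq_map => v; exact: (weight_shift wl wm false).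
elim/pterm_ind_in: t u => [n|t IH|t vs IH _|b t IH] u //.
- move=> [u' -> /IH[H|[E H]|[E1 E2 E3 E4 H]]] /=.
  + by constructor 1.
  + by constructor 2; rewrite E.
  + by constructor 3; split; rewrite ?E1 ?E2.
- have ctx w : hstep t w ->
    [\/ nlam (PApp w vs) < nlam (PApp t vs),
      nlam (PApp w vs) = nlam (PApp t vs) /\ nmu (PApp w vs) < nmu (PApp t vs) |
      [/\ nlam (PApp w vs) = nlam (PApp t vs), nmu (PApp w vs) = nmu (PApp t vs),
          copies (PApp w vs) = copies (PApp t vs),
          forall d, copies_at (PApp w vs) d = copies_at (PApp t vs) d &
          pending (PApp w vs) < pending (PApp t vs)]].
    move=> /IH[H|[E H]|[E1 E2 E3 E4 H]] /=.
    + by constructor 1; rewrite ltn_add2r.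
    + by constructor 2; rewrite E ltn_add2r.
    + by constructor 3; split=> [|||d|]; rewrite ?E1 ?E2 ?E4 //; lia.
  case: t IH ctx => [n|r|r ws|b r] _ ctx.
  + by move=> [? _ []].
  + move=> H; constructor 1; rewrite (act_weight 1 0 H) res_sum_keyed /=; lia.
  + by move=> [w -> /ctx].
  + move=> [c [w [-> H]]]; have [E1 E2 E3] := mu_to_copies H.
    constructor 3; split=> //=.
      by rewrite (nact_weight 1 0 H) sum_shift.
    by rewrite (nact_weight 0 1 H) sum_shift addnA.
- have ctx w : hstep t w ->
    [\/ nlam (PMu b w) < nlam (PMu b t),
      nlam (PMu b w) = nlam (PMu b t) /\ nmu (PMu b w) < nmu (PMu b t) |
      [/\ nlam (PMu b w) = nlam (PMu b t), nmu (PMu b w) = nmu (PMu b t),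
          copies (PMu b w) = copies (PMu b t),
          forall d, copies_at (PMu b w) d = copies_at (PMu b t) d &
          pending (PMu b w) < pending (PMu b t)]].
    move=> /IH[H|[E H]|[E1 E2 E3 E4 H]] /=.
    + by constructor 1.
    + by constructor 2; rewrite E.
    + by constructor 3; split=> [|||d|]; rewrite ?E1 ?E2 ?E3 ?E4.
  case: t IH ctx => [n|r|r ws|e r] _ ctx.
  + by move=> [? _ []].
  + by move=> [w -> /ctx].
  + by move=> [w -> /ctx].
  + by move=> ->; constructor 2; rewrite /= !weight_pren.
Qed.

Fixpoint psize (t : pterm) : nat :=
  match t with
  | PVar _ => 0
  | PLam t | PMu _ t => (psize t).+1
  | PApp t vs => (psize t + sumn (map psize vs)).+1
  end.

(** The first three components serve the head steps. [psize] serves the passage to subterms, which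
    increases none of them. *)
Definition smaller u t :=
  [\/ nlam u < nlam t, nlam u = nlam t /\ nmu u < nmu t,
      [/\ nlam u = nlam t, nmu u = nmu t & pending u < pending t] |
      [/\ nlam u = nlam t, nmu u = nmu t, pending u = pending t & psize u < psize t]].

Lemma smaller_wf : well_founded smaller.
Proof.
move=> t; move: {2}(nlam t) (erefl (nlam t)) => a; elim/ltn_ind: a t => a IHa t.
move: {2}(nmu t) (erefl (nmu t)) => b; elim/ltn_ind: b t => b IHb t.
move: {2}(pending t) (erefl (pending t)) => c; elim/ltn_ind: c t => c IHc t.
move: {2}(psize t) (erefl (psize t)) => d; elim/ltn_ind: d t => d IHd t Ed Ec Eb Ea.
constructor=> u [H|[E H]|[E1 E2 H]|[E1 E2 E3 H]].
- by apply: (IHa (nlam u)) => //; rewrite -Ea.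
- by apply: (IHb (nmu u)); rewrite -?Eb // E.
- by apply: (IHc (pending u)); rewrite -?Ec // ?E1 ?E2.
- by apply: (IHd (psize u)); rewrite -?Ed // ?E1 ?E2 ?E3.
Qed.

Lemma smaller_le u t : nlam u <= nlam t -> nmu u <= nmu t ->
  pending u <= pending t -> psize u < psize t -> smaller u t.
Proof.
rewrite leq_eqVlt => /orP[/eqP E1|]; last by constructor 1.
rewrite leq_eqVlt => /orP[/eqP E2|]; last by constructor 2.
by rewrite leq_eqVlt => /orP[/eqP E3|]; [constructor 4 | constructor 3].
Qed.

Lemma hstep_smaller t u : hstep t u -> smaller u t.
Proof.
move=> /hstep_decr[H|H|[E1 E2 _ _ H]].
- by constructor 1.
- by constructor 2.
- by constructor 3.
Qed.

Lemma leq_sumn_map (f : pterm -> nat) vs v : v \in vs -> f v <= sumn (map f vs).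
Proof. by elim: vs => //= w vs IH; rewrite inE => /orP[/eqP->|/IH]; lia. Qed.

Lemma smaller_lam t : smaller t (PLam t).
Proof. exact: smaller_le. Qed.

Lemma smaller_mu b t : smaller t (PMu b t).
Proof. exact: smaller_le. Qed.

Lemma smaller_fun t vs : smaller t (PApp t vs).
Proof. by apply: smaller_le => /=; lia. Qed.

Lemma smaller_arg t vs v : v \in vs -> smaller v (PApp t vs).
Proof.
move=> vin; apply: smaller_le => /=.
- have := leq_sumn_map (weight 1 0) vin; lia.
- have := leq_sumn_map (weight 0 1) vin; lia.
- have := leq_sumn_map pending vin; lia.
- have := leq_sumn_map psize vin; lia.
Qed.

(** * Coherence *)

(** Elements of the same bag are related as well: an action may send any of them to the place where
    another one goes in the other term. *)
Inductive coh : pterm -> pterm -> Prop :=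
  | coh_var n : coh (PVar n) (PVar n)
  | coh_lam t s : coh t s -> coh (PLam t) (PLam s)
  | coh_app t s vs ws : coh t s ->
      (forall v w, v \in vs ++ ws -> w \in vs ++ ws -> coh v w) ->
      coh (PApp t vs) (PApp s ws)
  | coh_mu b t s : coh t s -> coh (PMu b t) (PMu b s).

Lemma taylor_coh M t s : taylor M t -> taylor M s -> coh (rep t) (rep s).
Proof.
elim: M t s => [n|M IH|M IHM N IHN|b M IH] t s /=.
- by move=> -> ->; exact: coh_var.
- move=> [t' Ht ->] [s' Hs ->] /=; rewrite !rep_canon; exact/coh_lam/IH.
- move=> [t' [B [Ht HB ->]]] [s' [C [Hs HC ->]]] /=; rewrite !rep_canon.
  have bag_in (D : {mset rterm}) v : (forall v, v \in D -> taylor N v) ->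
      v \in sort pterm_le (map canon (map rep D)) -> exists2 v', taylor N v' & v = rep v'.
    move=> HD; rewrite mem_sort -map_comp => /mapP[v' vin ->] /=.
    by exists v'; [exact: HD | exact: rep_canon].
  apply: coh_app; first exact: IHM.
  move=> v w; rewrite !mem_cat.
  move=> /orP[/bag_in|/bag_in] [] // v' Hv -> /orP[/bag_in|/bag_in] [] // w' Hw ->;
    exact: IHN.
- move=> [t' Ht ->] [s' Hs ->] /=; rewrite !rep_canon; exact/coh_mu/IH.
Qed.

Lemma coh_pren t s : coh t s -> forall f g, coh (pren f g t) (pren f g s).
Proof.
elim=> {t s} [n|t s _ IH|t s vs ws _ IHt _ IH|b t s _ IH] f g /=.
- exact: coh_var.
- exact/coh_lam/IH.
- apply: coh_app; first exact: IHt.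
  by move=> v w; rewrite -!map_cat => /mapP[v' Hv ->] /mapP[w' Hw ->]; exact: IH.
- exact/coh_mu/IH.
Qed.

Definition clique (K : seq res) := forall p q,
  p \in K -> q \in K -> p.1 = q.1 -> coh p.2 q.2.

Lemma clique_lift c K : clique K -> clique (lift_res c K).
Proof.
move=> HK _ _ /mapP[p pK ->] /mapP[q qK ->] /= /shift_key_inj E.
by case: c; apply: coh_pren; exact: HK.
Qed.

Lemma perm_sub_cat (T : eqType) (R A B K : seq T) :
  perm_eq R (A ++ B) -> {subset R <= K} -> {subset A <= K} /\ {subset B <= K}.
Proof.
move=> p sRK; split=> x xin; apply: sRK; rewrite (perm_mem p) mem_cat xin //.
exact: orbT.
Qed.

Lemma bag_rel_mem P vs R us u : bag_rel P vs R us -> u \in us ->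
  exists v R0, [/\ v \in vs, {subset R0 <= R} & P v R0 u].
Proof.
elim: vs R us => [|v vs IH] R [|w us] //= [R0 [R1 [p Hv Hvs]]].
have [s0 s1] := perm_sub_cat p (fun _ h => h).
rewrite inE => /orP[/eqP->|uin].
  by exists v, R0; split=> //; exact: mem_head.
have [x [S [xin sS Hx]]] := IH _ _ Hvs uin.
exists x, S; split=> //; first by rewrite inE xin orbT.
by move=> y /sS/s1.
Qed.

Lemma nact_coh_of t s b th K R R' c d u w :
  (forall R R' u w, {subset R <= K} -> {subset R' <= K} ->
    act t th R u -> act s th R' w -> coh u w) ->
  clique K -> {subset R <= K} -> {subset R' <= K} ->
  nact b t th R c u -> nact b s th R' d w -> c = d /\ coh u w.
Proof.
move=> IH HK sR sR' [-> Hu] [-> Hw]; split=> //; move: Hu Hw.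
case: (na th b); last exact: IH.
move=> [R1 [B [u' [-> p Hu]]]] [R1' [B' [w' [-> p' Hw]]]].
have [s1 s2] := perm_sub_cat p sR; have [s1' s2'] := perm_sub_cat p' sR'.
apply: coh_app; first exact: IH Hu Hw.
have inK v : v \in B ++ B' -> (inr b, v) \in K.
  rewrite mem_cat => /orP[] vin; [apply: s2 | apply: s2'];
  exact: (map_f (pair (inr b)) vin).
by move=> v v' /inK vK /inK v'K; exact: (HK _ _ vK v'K).
Qed.

(** [K] is one fixed pool containing both families of resources, so the clique condition survives
    every splitting. Two resources with the same key may meet at one variable or in the bags of one
    named subterm. *)
Lemma coh_act t s : coh t s -> forall th K R R' u w,
  clique K -> {subset R <= K} -> {subset R' <= K} ->
  act t th R u -> act s th R' w -> coh u w.
Proof.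
have sub_lift c (R K : seq res) : {subset R <= K} ->
    {subset lift_res c R <= lift_res c K}.
  by move=> sRK _ /mapP[p pR ->]; apply/map_f/sRK.
elim=> {t s} [n|t s _ IH|t s vs ws _ IHt _ IH|b t s _ IH] th K R R' u w HK sR sR' /=.
- case: (vr th n) => [m [_ ->] [_ ->]|ER ER']; first exact: coh_var.
  apply: (HK (inl n, u) (inl n, w)) => //; [apply: sR | apply: sR'];
  by rewrite ?ER ?ER' mem_head.
- move=> [u' -> Hu] [w' -> Hw]; apply: coh_lam.
  exact: IH (clique_lift HK) (sub_lift _ _ _ sR) (sub_lift _ _ _ sR') Hu Hw.
- move=> [u' [us [R0 [R1 [-> p Ht HB]]]]] [w' [xs [R0' [R1' [-> p' Ht' HB']]]]].
  have [s1 s2] := perm_sub_cat p sR; have [s1' s2'] := perm_sub_cat p' sR'.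
  apply: coh_app; first exact: IHt HK s1 s1' Ht Ht'.
  have H x : x \in us ++ xs ->
      exists v S, [/\ v \in vs ++ ws, {subset S <= K} & act v th S x].
    rewrite mem_cat => /orP[/(bag_rel_mem HB)|/(bag_rel_mem HB')] [v [S [vin sS Hv]]];
    exists v, S; split=> //; rewrite ?mem_cat ?vin ?orbT // => y /sS;
    [exact: s2 | exact: s2'].
  move=> x y /H[v [S [vin sS Hv]]] /H[v' [S' [vin' sS' Hv']]].
  exact: IH HK sS sS' Hv Hv'.
- move=> [c [u' [-> Hu]]] [d [w' [-> Hw]]].
  have [-> H] := nact_coh_of
    (fun R R' u w => IH _ _ R R' u w (clique_lift (c := false) HK))
    (clique_lift HK) (sub_lift _ _ _ sR) (sub_lift _ _ _ sR') Hu Hw.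
  exact: coh_mu.
Qed.

Lemma nact_coh t s b th K R R' c d u w : coh t s ->
  clique K -> {subset R <= K} -> {subset R' <= K} ->
  nact b t th R c u -> nact b s th R' d w -> c = d /\ coh u w.
Proof.
move=> H HK; apply: nact_coh_of => // S S' x y sS sS'.
exact: coh_act H _ _ _ _ _ _ HK sS sS'.
Qed.

Lemma coh_has_head t s : coh t s -> has_head t = has_head s.
Proof.
by elim=> //= [{}t {}s vs ws Hts IH _ _|b {}t {}s Hts IH];
  case: Hts IH.
Qed.

Lemma clique_keyed k c vs ws :
  (forall v w, v \in vs ++ ws -> w \in vs ++ ws -> coh v w) ->
  clique (keyed k (map (pren id c) (vs ++ ws))).
Proof.
move=> H _ _ /mapP[_ /mapP[v vin ->] ->] /mapP[_ /mapP[w win ->] ->] _ /=.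
exact/coh_pren/H.
Qed.

Lemma hstep_coh t s u w : coh t s -> hstep t u -> hstep s w -> coh u w.
Proof.
move=> H; elim: H u w => {t s} [n|t s _ IH|t s vs ws Hts IH Hvs _|b t s Hts IH] u w //.
- by move=> [u' -> Hu] [w' -> Hw]; exact/coh_lam/IH.
- have ctx x y : hstep t x -> hstep s y -> coh (PApp x vs) (PApp y ws).
    by move=> Hx Hy; apply: coh_app => //; exact: IH.
  have sub1 k f : {subset keyed k (map f vs) <= keyed k (map f (vs ++ ws))}.
    by move=> x; rewrite map_cat keyed_cat mem_cat => ->.
  have sub2 k f : {subset keyed k (map f ws) <= keyed k (map f (vs ++ ws))}.
    by move=> x; rewrite map_cat keyed_cat mem_cat => ->; rewrite orbT.
  case: Hts ctx {IH} => [n|{}t {}s Hts|{}t {}s vs' ws' _ _|b {}t {}s Hts] ctx /=.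
  + by move=> [? _ []].
  + have HK := clique_keyed (k := inl 0) (c := id) Hvs.
    have Eid (xs : seq pterm) : xs = map (pren id id) xs.
      by rewrite -[LHS]map_id; apply: eq_map => x; rewrite pren_id.
    rewrite /beta_to (Eid vs) (Eid ws).
    exact: coh_act Hts _ _ _ _ _ _ HK (sub1 _ _) (sub2 _ _).
  + by move=> [x -> Hx] [y -> Hy]; exact: ctx.
  + move=> [c [x [-> Hx]]] [d [y [-> Hy]]].
    have HK := clique_keyed (k := inr 0) (c := succn) Hvs.
    have [-> H] := nact_coh Hts HK (sub1 _ _) (sub2 _ _) Hx Hy.
    exact: coh_mu.
- have ctx x y : hstep t x -> hstep s y -> coh (PMu b x) (PMu b y).
    by move=> Hx Hy; apply: coh_mu; exact: IH.
  case: Hts ctx {IH} => [n|{}t {}s Hts|{}t {}s vs' ws' _ _|e {}t {}s Hts] ctx /=.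
  + by move=> [? _ []].
  + by move=> [x -> Hx] [y -> Hy]; exact: ctx.
  + by move=> [x -> Hx] [y -> Hy]; exact: ctx.
  + by move=> -> ->; exact/coh_mu/coh_pren.
Qed.

(** * Injectivity of actions and of head steps on coherent terms *)

Definition eq_res (R R' : seq res) :=
  perm_eq (map canon_res R) (map canon_res R').

Lemma eq_res_cat R R' A A' B B' : perm_eq R (A ++ B) -> perm_eq R' (A' ++ B') ->
  eq_res A A' -> eq_res B B' -> eq_res R R'.
Proof.
move=> p p' HA HB; rewrite /eq_res.
rewrite (permPl (perm_map canon_res p)) (permPr (perm_map canon_res p')) !map_cat.
exact: perm_cat.
Qed.

(** The predecessor on indices is a left inverse of the shift, both on keys and on payloads, and
    renamings respect [canon]. *)
Lemma eq_res_unlift c R R' : eq_res (lift_res c R) (lift_res c R') -> eq_res R R'.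
Proof.
pose unkey (k : key) : key := match c, k with
  | true, inl n => inl n.-1 | false, inr n => inr n.-1 | _, _ => k end.
pose unshift := if c then pren predn id else pren id predn.
pose f (p : res) : res := (unkey p.1, canon (unshift p.2)).
have Ef S : map f (map canon_res (lift_res c S)) = map canon_res S.
  rewrite -!map_comp; apply: eq_map => -[k v] /=.
  rewrite /f /canon_res /=; congr (_, _).
    by rewrite /unkey; case: (c) k => -[].
  rewrite /unshift; case: (c) => /=;
  by rewrite canon_pren_canon pren_comp
       (pren_ext _ (_ : _ =1 id) (_ : _ =1 id)) // pren_id.
by move=> /(perm_map f); rewrite !Ef.
Qed.

Lemma eq_res_keyed k B B' :
  eq_res (keyed k B) (keyed k B') <-> perm_eq (map canon B) (map canon B').
Proof.
have E S : map canon_res (keyed k S) = map (pair k) (map canon S).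
  by rewrite /keyed -!map_comp.
rewrite /eq_res !E; split=> [/(perm_map snd)|]; last exact: perm_map.
by rewrite -!(map_comp snd) !map_id.
Qed.

Lemma nact_inj_of t s b th R R' c d u w :
  (forall R R' u w, act t th R u -> act s th R' w -> canon u = canon w ->
    canon t = canon s /\ eq_res R R') ->
  nact b t th R c u -> nact b s th R' d w -> canon u = canon w ->
  canon t = canon s /\ eq_res R R'.
Proof.
move=> IH [_ +] [_ +]; case: (na th b); last exact: IH.
move=> [R1 [B [u' [-> p Hu]]]] [R1' [B' [w' [-> p' Hw]]]] /canon_appP[E EB].
have [-> HR] := IH _ _ _ _ Hu Hw E; split=> //.
by apply: (eq_res_cat p p' HR); apply/eq_res_keyed.
Qed.

(** Coherent variables are equal, so both are renamed or both are replaced by their single resource;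
    this excludes that [x] with the resource [y] and [y] with none give the same result. In a bag,
    equality of the results imposes some pairing of the arguments, and coherence covers every
    pair. *)
Lemma act_inj t s : coh t s -> forall th R R' u w,
  act t th R u -> act s th R' w -> canon u = canon w ->
  canon t = canon s /\ eq_res R R'.
Proof.
elim=> {t s} [n|t s _ IH|t s vs ws _ IHt _ IH|b t s _ IH] th R R' u w /=.
- case: (vr th n) => [m [-> ->] [-> ->]|-> ->] //= E; split=> //.
  by rewrite /eq_res /= /canon_res /= E.
- move=> [u' -> Hu] [w' -> Hw] [E].
  by have [-> /eq_res_unlift] := IH _ _ _ _ _ Hu Hw E.
- move=> [u' [us [R0 [R1 [-> p Ht HB]]]]] [w' [xs [S0 [S1 [-> p' Ht' HB']]]]].
  move=> /canon_appP[E /canon_bag_perm[ys pys Eys]].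
  have [Ets H0] := IHt _ _ _ _ _ Ht Ht' E.
  have [|zs pzs HB2] := bag_rel_perm_out HB' (us' := ys); first by rewrite perm_sym.
  suff [Evs H1] : map canon vs = map canon zs /\ eq_res R1 S1.
    split; last exact: eq_res_cat p p' H0 H1.
    by apply/canon_appP; split=> //; rewrite Evs perm_sym; exact: perm_map.
  have {}IH v z : v \in vs -> z \in zs -> forall th R R' u w,
      act v th R u -> act z th R' w -> canon u = canon w ->
      canon v = canon z /\ eq_res R R'.
    move=> vin zin; apply: IH; rewrite mem_cat ?vin // (perm_mem pzs) zin.
    exact: orbT.
  elim: vs us zs ys R1 S1 HB HB2 Eys IH {p p' pys pzs HB'}
    => [|v vs IHvs] [|x us] [|z zs] [|y ys] R1 S1 //=.
    by move=> -> ->.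
  move=> [A0 [A1 [p Hv Hvs]]] [B0 [B1 [p' Hz Hzs]]] [Exy Eys] IH.
  have [-> HA] := IH _ _ (mem_head _ _) (mem_head _ _) _ _ _ _ _ Hv Hz Exy.
  have [|-> HA1] := IHvs _ _ _ _ _ Hvs Hzs Eys.
    by move=> a b ain bin; apply: IH; rewrite inE ?ain ?bin orbT.
  by split=> //; exact: eq_res_cat p p' HA HA1.
- move=> [c [u' [-> Hu]]] [d [w' [-> Hw]]] [_ E].
  have [-> /eq_res_unlift] := nact_inj_of (IH _) Hu Hw E; by split.
Qed.

Lemma nact_inj t s b th R R' c d u w : coh t s ->
  nact b t th R c u -> nact b s th R' d w -> canon u = canon w ->
  canon t = canon s /\ eq_res R R'.
Proof. by move=> /act_inj H; apply: nact_inj_of => S S' x y; exact: H. Qed.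

Lemma hstep_inj t s u w : coh t s -> hstep t u -> hstep s w ->
  canon u = canon w -> canon t = canon s.
Proof.
move=> H; elim: H u w => {t s} [n|t s _ IH|t s vs ws Hts IH _ _|b t s Hts IH] u w //.
- by move=> [u' -> Hu] [w' -> Hw] [/(IH _ _ Hu Hw) /= ->].
- have ctx x y : hstep t x -> hstep s y -> canon (PApp x vs) = canon (PApp y ws) ->
      canon (PApp t vs) = canon (PApp s ws).
    by move=> Hx Hy /canon_appP[E EB]; apply/canon_appP; split=> //; exact: IH Hx Hy E.
  case: Hts ctx {IH} => [n|{}t {}s Hts|{}t {}s vs' ws' _ _|b {}t {}s Hts] ctx.
  + by move=> [? _ []].
  + move=> Hu Hw E; have [Et /eq_res_keyed HB] := act_inj Hts Hu Hw E.
    by apply/canon_appP; rewrite /= Et.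
  + by move=> [x -> Hx] [y -> Hy]; exact: ctx.
  + move=> [c [x [-> Hx]]] [d [y [-> Hy]]] [_ E].
    have [Et HB] := nact_inj Hts Hx Hy E; apply/canon_appP; rewrite /= Et; split=> //.
    (* The bag is shifted but its key, the bound name 0, is not a lifted one. A variable key is
       unaffected by a mu-binder, so under such a key the whole list is a lift. *)
    move: HB => /eq_res_keyed/(eq_res_keyed (inl 0)).
    by rewrite -!lift_keyed_vn => /eq_res_unlift/eq_res_keyed.
- have ctx x y : hstep t x -> hstep s y -> canon (PMu b x) = canon (PMu b y) ->
      canon (PMu b t) = canon (PMu b s).
    by move=> Hx Hy /= [/(IH _ _ Hx Hy) ->].
  case: Hts ctx {IH} => [n|{}t {}s Hts|{}t {}s vs' ws' _ _|e {}t {}s Hts] ctx.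
  + by move=> [? _ []].
  + by move=> [x -> Hx] [y -> Hy]; exact: ctx.
  + by move=> [x -> Hx] [y -> Hy]; exact: ctx.
  + move=> -> -> [E].
    (* [nsubst b] merges two names, yet coherent terms have the same names at the same places; seen
       as an action without resources, the renaming falls under [act_inj]. *)
    have Ht : act t (ren_env id (nsubst b)) [::] (pren id (nsubst b) t).
      exact/act_ren_env.
    have Hs : act s (ren_env id (nsubst b)) [::] (pren id (nsubst b) s).
      exact/act_ren_env.
    by have [/= ->] := act_inj Hts Ht Hs E.
Qed.

(** * Head normal forms *)

(** A head redex could only arise from a function part or a mu-body changing its outermost
    constructor, which requires firing a head redex there. *)
Lemma hnf_pstep t u : pstep t u -> ~~ has_head t -> ~~ has_head u /\ ctor u = ctor t.
Proof.
case=> [H|E]; last first.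
  rewrite -has_head_canon E has_head_canon => ->; split=> //.
  by case: t u E => [?|?|? ?|? ?] [?|?|? ?|? ?].
elim: H => //= {t u}.
- by move=> t u _ IH /IH[].
- move=> t u vs Htu IH Hh.
  have Ht : ~~ has_head t by case: t Hh {Htu IH}.
  have [Hu Ec] := IH Ht; split=> //.
  by case: t u Ec Hh Hu {Htu IH Ht} => [?|?|? ?|? ?] [?|?|? ?|? ?].
- move=> b t u Htu IH Hh.
  have Ht : ~~ has_head t by case: t Hh {Htu IH}.
  have [Hu Ec] := IH Ht; split=> //.
  by case: t u Ec Hh Hu {Htu IH Ht} => [?|?|? ?|? ?] [?|?|? ?|? ?].
Qed.

Lemma psteps_lam_inv t u : psteps (PLam t) u -> exists2 u', u = PLam u' & psteps t u'.
Proof.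
move=> H0; have H := Operators_Properties.clos_rt_rt1n _ _ _ _ H0.
clear H0; remember (PLam t) as x eqn:Ex in H.
elim: H t Ex => {x u} [x|x y u Hxy _ IH] t Ex; subst x.
  by exists t => //; exact: rt_refl.
case: Hxy => [Hs|E].
  inversion Hs as [| | |t0 y' Hy| | |]; subst.
  have [u' -> Hu] := IH _ erefl; exists u' => //.
  by apply: rt_trans Hu; apply: rt_step; left.
case: y E IH => // y' [E] /(_ _ erefl)[u' -> Hu]; exists u' => //.
by apply: rt_trans Hu; exact: psteps_canon.
Qed.

Lemma psteps_mu_inv b t u : psteps (PMu b t) u -> ~~ has_head (PMu b t) ->
  exists2 u', u = PMu b u' & psteps t u'.
Proof.
move=> H0; have H := Operators_Properties.clos_rt_rt1n _ _ _ _ H0.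
clear H0; remember (PMu b t) as x eqn:Ex in H.
elim: H t Ex => {x u} [x|x y u Hxy _ IH] t Ex Hh; subst x.
  by exists t => //; exact: rt_refl.
have [Hy _] := hnf_pstep Hxy Hh.
case: Hxy => [Hs|E].
  inversion Hs as [| |a e r| | | |b0 t0 y' Hy']; subst; first by [].
  have [u' -> Hu] := IH _ erefl Hy; exists u' => //.
  by apply: rt_trans Hu; apply: rt_step; left.
case: y E IH Hy => // b' y' [<- E] IH Hy; have [u' -> Hu] := IH _ erefl Hy.
by exists u' => //; apply: rt_trans Hu; exact: psteps_canon.
Qed.

(** [L] pairs each argument with the end of its own thread. Relistings along the way shuffle the
    arguments, so these ends match [us] only up to permutation and [canon]. *)
Lemma psteps_app_inv t vs u : psteps (PApp t vs) u -> ~~ has_head (PApp t vs) ->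
  exists u' us (L : seq (pterm * pterm)),
  [/\ u = PApp u' us, psteps t u', vs = map fst L,
      perm_eq (map (canon \o snd) L) (map canon us) &
      forall x, x \in L -> psteps x.1 x.2].
Proof.
move=> H0; have H := Operators_Properties.clos_rt_rt1n _ _ _ _ H0.
clear H0; remember (PApp t vs) as x eqn:Ex in H.
elim: H t vs Ex => {x u} [x|x y u Hxy _ IH] t vs Ex Hh; subst x.
  exists t, vs, [seq (v, v) | v <- vs]; split=> //.
  - exact: rt_refl.
  - by rewrite -map_comp map_id.
  - by rewrite -map_comp.
  - by move=> _ /mapP[v _ ->]; exact: rt_refl.
have [Hy _] := hnf_pstep Hxy Hh.
case: Hxy => [Hs|E].
  inversion Hs as [| | | |t0 t' vs0 Ht|t0 v w l l' Hvw|]; subst; try by [].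
    have [u' [us [L [-> Hu -> p HL]]]] := IH _ _ erefl Hy.
    exists u', us, L; split=> //; apply: rt_trans Hu; apply: rt_step; by left.
  have [u' [us [L [-> Hu EL p HL]]]] := IH _ _ erefl Hy.
  have [L1 [[|[w' x] L2] [E <- //= [Ew <-]]]] := map_cat_inv (esym EL); subst L w'.
  exists u', us, (L1 ++ (v, x) :: L2); split=> //.
  - by rewrite map_cat.
  - by move: p; rewrite !map_cat.
  - move=> z; rewrite mem_cat inE => /or3P[zin|/eqP->|zin].
    + by apply: HL; rewrite mem_cat zin.
    + apply: (rt_trans _ _ _ w); first by apply: rt_step; left.
      by apply: (HL (w, x)); rewrite mem_cat mem_head orbT.
    + by apply: HL; rewrite mem_cat inE zin !orbT.
case: y E IH Hy => // t1 vs1 /canon_appP[Et Evs] IH Hy.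
have [u' [us [L1 [-> Hu EL p HL]]]] := IH _ _ erefl Hy; subst vs1.
move: Evs; rewrite -map_comp => /perm_map_inv[L2 pL EL2].
suff [L [EL Es HL']] : exists L : seq (pterm * pterm),
    [/\ vs = map fst L, map snd L = map snd L2 & forall x, x \in L -> psteps x.1 x.2].
  exists u', us, L; split=> //.
    by apply: rt_trans Hu; exact: psteps_canon.
  rewrite map_comp Es -map_comp; apply: perm_trans p; apply: perm_map.
  by rewrite perm_sym.
have {}HL x : x \in L2 -> psteps x.1 x.2 by rewrite -(perm_mem pL); exact: HL.
elim: vs L2 EL2 HL {Hh pL} => [|v vs IHvs] [|x L2] //= => [_ _|[Ev /IHvs H] HL].
  by exists [::].
have [|L [-> <- HL']] := H; first by move=> z zin; apply: HL; rewrite inE zin orbT.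
exists ((v, x.2) :: L); split=> // z; rewrite inE => /orP[/eqP->|/HL'//].
apply: (rt_trans _ _ _ x.1); first exact: psteps_canon.
by apply: HL; exact: mem_head.
Qed.

(** The induction is on [t] alone and leaves [s] and both threads arbitrary, as standardization
    gives no bound on their lengths. Head steps are pulled back by [hstep_inj]. *)
Lemma coh_common_normal_form t s u w : coh t s -> psteps t u -> psteps s w ->
  canon u = canon w -> normal u -> canon t = canon s.
Proof.
elim/(well_founded_ind smaller_wf): t s u w => t IH s u w Hts Htu Hsw E Hu.
have Hw := normal_canon E Hu.
case Ht: (has_head t).
  have Hs : has_head s by rewrite -(coh_has_head Hts).
  have [t2 Ht2 Htu2] := head_standardization Htu Hu Ht.
  have [s2 Hs2 Hsw2] := head_standardization Hsw Hw Hs.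
  apply: (hstep_inj Hts Ht2 Hs2).
  by apply: (IH _ (hstep_smaller Ht2) _ _ _ (hstep_coh Hts Ht2 Hs2) Htu2 Hsw2).
have {}Ht : ~~ has_head t by rewrite Ht.
have Hs : ~~ has_head s by rewrite -(coh_has_head Hts).
case: Hts IH Htu Hsw Ht Hs => {t s}
  [n|t s Hts|t s vs ws Hts Hvs|b t s Hts] IH Htu Hsw Ht Hs //.
- have [u' Eu Htu'] := psteps_lam_inv Htu; have [w' Ew Hsw'] := psteps_lam_inv Hsw.
  subst u w; case: E => E.
  by rewrite /= (IH _ (smaller_lam t) _ _ _ Hts Htu' Hsw' E (normal_lam Hu)).
- have [u' [us [L [Eu Htu' EL pL HL]]]] := psteps_app_inv Htu Ht.
  have [w' [xs [L' [Ew Hsw' EL' pL' HL']]]] := psteps_app_inv Hsw Hs.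
  subst u w vs ws; move: E => /canon_appP[E EB].
  apply/canon_appP; split.
    exact: IH (smaller_fun _ _) _ _ _ Hts Htu' Hsw' E (normal_fun Hu).
  (* The common bag of normal forms pairs the arguments of [t] with those of [s]; any such pair is
     coherent, so the induction hypothesis applies whatever the pairing. *)
  have : perm_eq (map (canon \o snd) L) (map (canon \o snd) L').
    by rewrite (permPl pL) (permPl EB) perm_sym.
  move=> /perm_map_inv[L2 pL2 E2].
  suff -> : map canon (map fst L) = map (canon \o fst) L2.
    by rewrite -map_comp perm_sym; exact: perm_map.
  have {}HL' x : x \in L2 -> psteps x.1 x.2 by rewrite -(perm_mem pL2); exact: HL'.
  have Hn x : x \in L -> normal x.2.
    move=> xin; have : canon x.2 \in map canon us.
      by rewrite -(perm_mem pL) (map_f (canon \o snd)).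
    by move=> /mapP[y yin Ey]; apply: normal_canon (normal_arg Hu yin).
  have Hc x y : x \in L -> y \in L2 -> coh x.1 y.1.
    move=> xin yin; apply: Hvs; rewrite mem_cat ?(map_f fst xin) //.
    by rewrite -(perm_mem pL2) in yin; rewrite (map_f fst yin) orbT.
  have {}IH x y : x \in L -> y \in L2 -> canon x.2 = canon y.2 -> canon x.1 = canon y.1.
    move=> xin yin Exy; apply: (IH x.1 _ y.1 x.2 y.2) => //.
    + by apply: smaller_arg; exact: map_f.
    + exact: Hc.
    + exact: HL.
    + exact: HL'.
    + exact: Hn.
  elim: L L2 E2 IH {pL pL2 HL HL' Hn Hc Hvs Htu Ht Hu EB} => [|x L IHL] [|y L2] //=.
  move=> [Exy E2] IH; rewrite (IH x y) ?mem_head // (IHL L2) // => a b ain bin.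
  by apply: IH; rewrite inE ?ain ?bin orbT.
- have [u' Eu Htu'] := psteps_mu_inv Htu Ht; have [w' Ew Hsw'] := psteps_mu_inv Hsw Hs.
  subst u w; case: E => E.
  by rewrite /= (IH _ (smaller_mu b t) _ _ _ Hts Htu' Hsw' E (normal_mu Hu)).
Qed.

Theorem theorem3p6 (M : lmterm) (t s : rterm) :
  taylor M t -> taylor M s -> t <> s ->
  forall St Ss : {fset rterm}, is_nf t St -> is_nf s Ss ->
  (St `&` Ss)%fset = fset0.
Proof.
move=> Ht Hs Hts St Ss HSt HSs; apply/fsetP => u; rewrite in_fset0.
apply: contra_notF Hts; rewrite in_fsetI => /andP[uSt uSs].
have [Htu Hn] := is_nf_psteps HSt uSt; have [Hsu _] := is_nf_psteps HSs uSs.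
rewrite -(cls_rep t) -(cls_rep s); apply/eq_clsP.
exact: coh_common_normal_form (taylor_coh Ht Hs) Htu Hsu erefl Hn.
Qed.
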